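(* Let $A_1,A_2,A_3$ be positive numbers and let $\mathcal F_1$ be the class of nonincreasing (differentiable) functions $\mu$ on $[0,1]$ such that $A_1<|\mu'(t)|<A_2$ and $|\mu(t)|\le A_3$ for all $t\in[0,1]$. Assume that $X$ has a density $f$ on $[0,1]$ which is bounded and bounded away from zero, and that there exist $K>0$ and $\alpha>0$ such that the error $\varepsilon=Y-\mu(X)$ satisfies $\mathbb E(e^{\theta\varepsilon}|X)\le K\exp(\theta^2\alpha)$ a.e. for all $\theta\in\mathbb R$. Then for any $p\ge1$ there exists $K_p>0$ such that 1. $\displaystyle\limsup_{n\to\infty}\ \sup_{\mu\in\mathcal F_1}n^{p/3}\,\mathbb E_\mu\left(|\hat\mu_n^{-1}(a)-\mu^{-1}(a)|^p\right)\le K_p$ for all fixed $a\in\mathbb R$; 2. $\displaystyle\limsup_{n\to\infty}\ \sup_{\mu\in\mathcal F_1}n^{p/3}\,\mathbb E_\mu\left(|\hat\mu_n(t)-\mu(t)|^p\right)\le K_p$ for all fixed $t\in(0,1)$.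
   Context: For $\mu\in\mathcal F_1$, $\mathbb E_\mu$ denotes expectation when $(X_1,Y_1),\dots,(X_n,Y_n)$ are independent copies of $(X,Y)\in[0,1]\times\mathbb R$ with $\mathbb E(Y|X=x)=\mu(x)$; the density $f$ of $X$ and the constants $K,\alpha$ in the exponential moment condition do not depend on $\mu$. Let $X_{(1)}<\dots<X_{(n)}$ be the order statistics of $X_1,\dots,X_n$ and $Y_{(i)}$ the observation corresponding to $X_{(i)}$. $\Lambda_n$ is the continuous function on $[0,1]$, linear on each $[(i-1)/n,i/n]$, with $\Lambda_n(i/n)=\frac1n\sum_{j\le i}Y_{(j)}$ for $i=0,\dots,n$. $\hat\lambda_n$ is the left-hand slope of the least concave majorant of $\Lambda_n$ on $[0,1]$, with $\hat\lambda_n(0)=\lim_{t\downarrow0}\hat\lambda_n(t)$. The nonincreasing least squares estimator $\hat\mu_n$ is the left-continuous piecewise constant function with $\hat\mu_n(X_{(i)})=\hat\lambda_n(i/n)$, $i=1,\dots,n$, constant on $[0,X_{(1)}]$ and on $(X_{(i-1)},X_{(i)}]$ for $i=2,\dots,n$, and equal to $\hat\lambda_n(1)$ on $(X_{(n)},1]$. For a nonincreasing left-continuous $h:[0,1]\to\mathbb R$, $h^{-1}(a)$ ($a\in\mathbb R$) is the greatest $t\in[0,1]$ with $h(t)\ge a$, with the convention that the supremum of the empty set is $0$. *)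

(* Defs.v *)
From HB Require Import structures.
From mathcomp Require Import all_boot all_order all_algebra.
From mathcomp Require Import all_classical all_reals all_analysis.

Set Implicit Arguments.
Unset Strict Implicit.
Unset Printing Implicit Defensive.
Import Order.TTheory GRing.Theory Num.Theory.
Import numFieldNormedType.Exports.
Local Open Scope classical_set_scope.
Local Open Scope ring_scope.

Section Functions.
Context {R : realType}.
Implicit Types (h mu : R -> R) (a t l : R).

(* Functions on [0, 1] are functions on R whose values off [0, 1] are
   irrelevant; hence the derivative is taken within [0, 1] (it is one-sided at
   0 and 1). *)
Definition has_deriv01 mu t l : Prop :=
  (fun s => (mu s - mu t) / (s - t)) @ within `[0, 1] t^' --> l.

Definition classF1 (A1 A2 A3 : R) : set (R -> R) := [set mu |
  {in `[0, 1] &, forall s t : R, s <= t -> mu t <= mu s} /\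
  (exists dmu : R -> R, forall t : R, t \in `[0, 1] ->
     has_deriv01 mu t (dmu t) /\ A1 < `|dmu t| < A2) /\
  (forall t : R, t \in `[0, 1] -> `|mu t| <= A3)].

(* For h nonincreasing and left-continuous the supremum is attained when the
   set is nonempty; sup set0 = 0 is the convention for the empty set. *)
Definition ginv h a : R := sup [set t | t \in `[0, 1] /\ a <= h t].

(* g is concave on [0, 1] *)
Definition concave01 (g : R -> R) : Prop :=
  convex_function (E := R^o) `[0, 1]%classic (fun x => - g x).

(* the pointwise infimum of the concave majorants on [0, 1] *)
Definition lc_majorant01 h t : R :=
  inf [set g t | g in [set g : R -> R |
    concave01 g /\ forall s : R, s \in `[0, 1] -> h s <= g s]].

Definition left_slope h t : R := lim ((h t - h s) / (t - s) @[s --> t^'-]).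

End Functions.

Section Estimator.
Context {R : realType} (n : nat) (z : nat -> R * R).

(* The sample z 0, ..., z n.-1 sorted by abscissa: the entry of index i
   (from 0) is (X_(i+1), Y_(i+1)). *)
Definition ordered_sample : seq (R * R) :=
  sort (fun u v => u.1 <= v.1) (mkseq z n).

Definition Xord (i : nat) : R := (nth (0, 0) ordered_sample i).1.
Definition Yord (i : nat) : R := (nth (0, 0) ordered_sample i).2.

(* On [k / n, (k + 1) / n] the linear interpolation of the normalized partial
   sums has slope Yord k. *)
Definition Lambda_n (t : R) : R :=
  let k := Num.truncn (n%:R * t) in
  n%:R^-1 * (\sum_(j < k) Yord j) + (t - k%:R / n%:R) * Yord k.

Definition lambda_hat (t : R) : R :=
  if t == 0 then lim (left_slope (lc_majorant01 Lambda_n) s @[s --> 0^'+])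
  else left_slope (lc_majorant01 Lambda_n) t.

(* k is the number of X_(i) that are < t, so t lies in (X_(k), X_(k+1)], with
   X_(0) = -oo; beyond X_(n) the index is capped at n. *)
Definition mu_hat (t : R) : R :=
  let k := find (fun u => t <= u.1) ordered_sample in
  lambda_hat ((minn k.+1 n)%:R / n%:R).

End Estimator.

Section Model.
Context {d : measure_display} {T : measurableType d} {R : realType}.
Variable P : probability T R.

(* x |-> g x is a version of E(Z | X = x), for X with values in [0, 1] *)
Definition is_cond_exp (Z X : T -> R) (g : R -> R) : Prop :=
  [/\ P.-integrable setT (EFin \o Z),
      measurable_fun (`[0, 1]%classic : set R) g,
      P.-integrable setT (EFin \o (g \o X)) &
      forall B : set R, measurable B ->
        (\int[P]_(w in X @^-1` B) (Z w)%:E =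
         \int[P]_(w in X @^-1` B) (g (X w))%:E)%E].

(* It suffices to consider the initial segments of a sequence, as some of the
   B i may be the whole space. *)
Definition mutually_independent (Zs : nat -> {mfun T >-> (R * R)%type}) :=
  forall (n : nat) (B : nat -> set (R * R)), (forall i, measurable (B i)) ->
    (P (\bigcap_(i < n) (Zs i @^-1` B i)) =
     \prod_(i < n) P (Zs i @^-1` B i))%E.

(* Under P, the Zs i = (X_i, Y_i) are independent copies of Z = (X, Y), X has
   density f on [0, 1], E(Y | X = x) = mu x, and the error Y - mu X satisfies
   the exponential moment condition with constants K and alpha. *)
Definition regression_model (f : R -> R) (K alpha : R) (mu : R -> R)
    (Z : {mfun T >-> (R * R)%type})
    (Zs : nat -> {mfun T >-> (R * R)%type}) : Prop :=
  let X w := (Z w).1 in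
  let Y w := (Z w).2 in
  let eps w := Y w - mu (X w) in
  [/\ mutually_independent Zs,
      forall i (B : set (R * R)), measurable B ->
        distribution P (Zs i) B = distribution P Z B,
      forall B : set R, measurable B ->
        P (X @^-1` B) = (\int[lebesgue_measure]_(x in B `&` `[0%R, 1%R])
                           (f x)%:E)%E,
      is_cond_exp Y X mu &
      forall theta : R, exists g : R -> R,
        is_cond_exp (fun w => expR (theta * eps w)) X g /\
        {ae P, forall w, g (X w) <= K * expR (theta ^+ 2 * alpha)}].

End Model.

(* Main.v *)
Require Import Defs.
From HB Require Import structures.
From mathcomp Require Import all_boot all_order all_algebra.
From mathcomp Require Import all_classical all_reals all_analysis.
From mathcomp Require Import ring lra measurable_realfun.
Import Order.TTheory GRing.Theory Num.Theory.
Import numFieldNormedType.Exports.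
Local Open Scope classical_set_scope.
Local Open Scope ring_scope.

(* With S_k the sum of the k first ordered responses, the left-hand slope at k/n
   of the least concave majorant is at most a as soon as some i < k satisfies
   S_l - S_i <= a (l - i) for all l >= k, and dually. Hence if the estimator
   exceeds mu by x at t, choose s to the left of t at a distance of order x: the
   errors of the observations between s and some u >= t have a mean of order at
   least x. Given the X_i, the products of likelihood ratios taken in their order
   form a martingale, and Doob's inequality for its first crossing bounds the
   probability of this event by exp(- kappa n x^3), whatever mu is.
   The inverses are compared in the same way, with t - s of order x. Summing over
   the levels x = k n^(-1/3) / 2 gives the moments. For mu_hat t this only works
   for x small enough that s stays in [0, 1]; the remaining event has an
   exponentially small probability, on which mu_hat is controlled crudely by the
   maximal error. *)

(** * Densities and independence *)

(** The points are visited in a random order, so there is no fixed filtration, and no conditional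
    law of the responses given the abscissae is constructed. Stopping is expressed with index sets
    instead: the initial segments of the order form a chain, and whether a segment [A] is the first
    to cross is decided by all the abscissae and the responses in [A]. Likelihood ratios outside [A]
    can then be inserted at no cost, each having conditional mean one. Such a ratio must have
    conditional mean exactly one and yet dominate the exponential of theta times the error up to a
    factor 1 + O(theta^2). It comes from a quadratic bound of the exponential, whose linear term is
    centered. With theta proportional to y, each point of a window (s, t] contributes a factor 1 -
    O(y^2). The random number of these points is integrated out as well, which gives the exponent n
    h y^2 for a window of length h; both h and y are of order x, hence the cube and the rate
    n^(1/3). The estimator enters only through inclusions in measurable events and through
    measurable majorants. *)

Section Density.
Local Open Scope ereal_scope.
Context {d : measure_display} {T : measurableType d} {R : realType}.
Variables (P : {measure set T -> \bar R}) (G : T -> R).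
Hypotheses (mG : measurable_fun [set: T] G) (G0 : forall x, (0 <= G x)%R).

Definition density_measure (A : set T) : \bar R := \int[P]_(x in A) (G x)%:E.

Let dens0 : density_measure set0 = 0.
Proof. by rewrite /density_measure integral_set0. Qed.

Let dens_ge0 A : 0 <= density_measure A.
Proof. by apply: integral_ge0 => x _; rewrite lee_fin. Qed.

Let dens_sigma : semi_sigma_additive density_measure.
Proof.
apply: semi_sigma_additive_nng_induced => [|x]; last by rewrite lee_fin.
exact/measurable_EFinP.
Qed.

HB.instance Definition _ := isMeasure.Build _ _ _ density_measure
  dens0 dens_ge0 dens_sigma.

Definition density : {measure set T -> \bar R} := density_measure.

Import HBNNSimple.

Lemma integral_density (f : T -> \bar R) : measurable_fun [set: T] f ->
  (forall x, 0 <= f x) ->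
  \int[density]_x f x = \int[P]_x ((G x)%:E * f x).
Proof.
move=> mf f0.
pose f_ := nnsfun_approx measurableT mf.
have nd : nondecreasing_seq (f_ : (T -> R)^nat) by exact: nd_nnsfun_approx.
have cv x : EFin \o f_^~x @ \oo --> f x by apply: cvg_nnsfun_approx => // t _.
have ndx x : {homo (fun n => f_ n x) : m n / (m <= n)%N >-> (m <= n)%R}.
  by move=> m n mn; exact/lefP/nd.
have mEG : measurable_fun [set: T] (fun x => (G x)%:E) by exact/measurable_EFinP.
rewrite (nd_ge0_integral_lim _ f0 ndx cv).
transitivity (limn (fun n => \int[P]_x ((G x)%:E * (f_ n x)%:E))); last first.
  rewrite -monotone_convergence//; last 3 first.
  - by move=> n; apply: emeasurable_funM => //; exact/measurable_EFinP.
  - by move=> n x _; rewrite -EFinM lee_fin mulr_ge0.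
  - by move=> x _ m n mn; rewrite -!EFinM lee_fin ler_wpM2l// ndx.
  by apply: eq_integral => x xT; apply: cvg_lim => //; apply: cvgeZl => //; exact: cv.
congr (limn _); apply/funext => n /=.
rewrite sintegralE.
have mi k : measurable (f_ n @^-1` [set k]) by [].
transitivity (\sum_(k \in range (f_ n))
    \int[P]_x ((G x)%:E * (k * \1_(f_ n @^-1` [set k]) x)%:E)).
  apply: eq_fsbigr => k; rewrite inE => -[x _ <-].
  under eq_integral do rewrite EFinM muleCA.
  rewrite ge0_integralZl//; last 3 first.
  - by apply: emeasurable_funM => //; exact/measurable_EFinP.
  - by move=> y _; rewrite -EFinM lee_fin mulr_ge0.
  - by rewrite lee_fin.
  congr (_ * _); rewrite -[LHS]/(\int[P]_(x in f_ n @^-1` [set f_ n x]) (G x)%:E).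
  rewrite [LHS]integral_mkcond.
  apply: eq_integral => y yT; rewrite patchE indicE.
  by case: ifP => _; rewrite ?mule1 ?mule0.
rewrite -ge0_integral_fsum//.
- apply: eq_integral => x xT; rewrite [in RHS]fimfunE -fsumEFin//.
  by rewrite ge0_mule_fsumr// => k; exact: nnfun_muleindic_ge0.
- move=> k; apply: emeasurable_funM => //.
  by apply/measurable_EFinP/measurable_funM.
- by move=> k x _; apply: mule_ge0; [rewrite lee_fin|exact: nnfun_muleindic_ge0].
Qed.

End Density.

Section ProductIntegral.
Local Open Scope ereal_scope.
Context {d d' : measure_display} {T : measurableType d} {S : measurableType d'}
  {R : realType}.
Variable P : probability T R.

(** The hypothesis says that the weights [G1] and [G2] have the same conditional expectation given
    [V]; the measures with these densities then have the same image under [V]. *)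
Lemma eq_integral_comp (V : T -> S) (G1 G2 : T -> R) (F : S -> R) :
  measurable_fun [set: T] V ->
  measurable_fun [set: T] G1 -> (forall x, 0 <= G1 x)%R ->
  measurable_fun [set: T] G2 -> (forall x, 0 <= G2 x)%R ->
  measurable_fun [set: S] F -> (forall x, 0 <= F x)%R ->
  (forall C, measurable C ->
     \int[P]_(x in V @^-1` C) (G1 x)%:E = \int[P]_(x in V @^-1` C) (G2 x)%:E) ->
  \int[P]_x (G1 x * F (V x))%:E = \int[P]_x (G2 x * F (V x))%:E.
Proof.
move=> mV mG1 G10 mG2 G20 mF F0 H.
have key (G : T -> R) (mG : measurable_fun [set: T] G) (G0 : forall x, (0 <= G x)%R) :
   \int[P]_x (G x * F (V x))%:E =
   \int[pushforward (density P G mG G0) V]_y (F y)%:E.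
  rewrite ge0_integral_pushforward//=; last 2 first.
  - exact/measurable_EFinP.
  - by move=> y _; rewrite lee_fin.
  rewrite preimage_setT integral_density//=; last 2 first.
  - by apply/measurable_EFinP/measurableT_comp.
  - by move=> x; rewrite lee_fin.
rewrite (key _ mG1 G10) (key _ mG2 G20).
by apply: eq_measure_integral => C mC _; exact: H.
Qed.

Variables (n : nat) (V : 'I_n -> T -> S).
Hypothesis mV : forall i, measurable_fun [set: T] (V i).
Hypothesis indepV : forall B : 'I_n -> set S, (forall i, measurable (B i)) ->
  P (\bigcap_(i in [set: 'I_n]) (V i @^-1` B i)) = \prod_(i < n) P (V i @^-1` B i).

(** Independence is given for events; functions replace the indicators one coordinate at a time. *)
Lemma integral_prod_indep (h : 'I_n -> S -> R) (e : 'I_n -> R) :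
  (forall i, measurable_fun [set: S] (h i)) -> (forall i s, 0 <= h i s)%R ->
  (forall i, \int[P]_x (h i (V i x))%:E = (e i)%:E) ->
  \int[P]_x (\prod_(i < n) h i (V i x))%:E = (\prod_(i < n) e i)%:E.
Proof.
move=> mh h0 he.
have mhV (g : 'I_n -> S -> R) i : (forall i, measurable_fun [set: S] (g i)) ->
    measurable_fun [set: T] (fun x => g i (V i x)).
  by move=> mg; exact: (measurableT_comp (mg i)).
(* Induction on [j]: only the factors of index below [j] may differ from indicators. *)
suff: forall j : nat, (j <= n)%N -> forall (h : 'I_n -> S -> R) (e : 'I_n -> R),
    (forall i, measurable_fun [set: S] (h i)) -> (forall i s, 0 <= h i s)%R ->
    (forall i, \int[P]_x (h i (V i x))%:E = (e i)%:E) ->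
    (forall i : 'I_n, (j <= i)%N ->
       exists B : set S, measurable B /\ h i = \1_B) ->
    \int[P]_x (\prod_(i < n) h i (V i x))%:E = (\prod_(i < n) e i)%:E.
  move=> /(_ n (leqnn _) h e mh h0 he); apply=> i.
  by rewrite leqNgt ltn_ord.
elim=> [_|j IH jn] {mh h0 he h e}h e mh h0 he hB.
  have {hB}/choice[B hB] i : exists B : set S, measurable B /\ h i = \1_B.
    exact: hB.
  transitivity (\int[P]_x (\1_(\bigcap_(i in [set: 'I_n]) (V i @^-1` B i)) x)%:E).
    apply: eq_integral => x xT; congr EFin; rewrite indicE.
    have [xB|xB] := boolP (x \in _).
      rewrite big1// => i _; rewrite (hB i).2 indicE mem_set//.
      by move: xB; rewrite inE => /(_ i I).
    have [i iB] : exists i, ~ B i (V i x).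
      apply/existsNP => xBi; move/negP: xB; apply; rewrite inE => i _.
      exact: xBi.
    by rewrite (bigD1 i)//= (hB i).2 indicE memNset// mul0r.
  have mVB i : measurable (V i @^-1` B i).
    by rewrite -[X in measurable X]setTI; apply: mV => //; exact: (hB i).1.
  rewrite integral_indic//; last exact: fin_bigcap_measurable.
  rewrite setIT; transitivity (\prod_(i < n) P (V i @^-1` B i)).
    by apply: indepV => i; exact: (hB i).1.
  rewrite -prodEFin; apply: eq_bigr => i _; rewrite -he (hB i).2.
  rewrite (_ : (fun x => (\1_(B i) (V i x))%:E) =
     (fun x => (\1_(V i @^-1` B i) x)%:E)); last by apply/funext.
  by rewrite integral_indic// setIT.
have ltjn : (j < n)%N by [].
pose i0 := Ordinal jn.
have e0 i : (0 <= e i)%R.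
  by rewrite -lee_fin -he; apply: integral_ge0 => x _; rewrite lee_fin.
pose G1 x := (\prod_(i < n | i != i0) h i (V i x))%R.
pose c := (\prod_(i < n | i != i0) e i)%R.
have mG1 : measurable_fun [set: T] G1.
  rewrite /G1; under eq_fun do rewrite -big_filter.
  by apply: measurable_prod => i _; exact: mhV.
transitivity (\int[P]_x (G1 x * h i0 (V i0 x))%:E).
  by apply: eq_integral => x _; rewrite (bigD1 i0)//= mulrC.
(* The product [G1] of the other factors has constant conditional expectation [c] given [V i0]:
   tested on an event of [V i0], this is the induction hypothesis. *)
rewrite (@eq_integral_comp (V i0) G1 (cst c) (h i0))//; last 3 first.
- by move=> x; apply: prodr_ge0.
- by move=> x; apply: prodr_ge0.
- move=> C mC.
  pose h' i := if i == i0 then \1_C else h i.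
  pose e' i := if i == i0 then fine (P (V i0 @^-1` C)) else e i.
  have mVC : measurable (V i0 @^-1` C).
    by rewrite -[X in measurable X]setTI; exact: mV.
  transitivity (\int[P]_x (\prod_(i < n) h' i (V i x))%:E).
    rewrite integral_mkcond; apply: eq_integral => x _; rewrite patchE.
    rewrite (bigD1 i0)//= /h' eqxx indicE [LHS](_ : _ =
       ((V i0 x \in C)%:R * G1 x)%:E).
      by congr ((_ * _)%:E); apply: eq_bigr => i /negbTE ->.
    rewrite (_ : (x \in _) = (V i0 x \in C)); last by apply/idP/idP; rewrite !inE.
    by case: ifP => _; rewrite ?mul1r ?mul0r.
  rewrite (IH (ltnW jn) h' e').
  - rewrite -[RHS]/(\int[P]_(x in V i0 @^-1` C) cst c%:E x) integral_cst//.
    rewrite (bigD1 i0)//= /e' eqxx EFinM fineK ?fin_num_measure//.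
    by rewrite muleC; congr (_%:E * _); apply: eq_bigr => i /negbTE ->.
  - by move=> i; rewrite /h'; case: ifP => // _; exact: measurable_indic.
  - by move=> i s; rewrite /h'; case: ifP => // _; rewrite indicE.
  - move=> i; rewrite /h' /e'; case: eqVneq => [->|_]; last exact: he.
    rewrite fineK ?fin_num_measure//.
    rewrite -(setIT (V i0 @^-1` C)) -integral_indic//.
  - move=> i ji; rewrite /h'; case: eqVneq => [_|ii0]; first by exists C.
    apply: hB; rewrite ltn_neqAle ji andbT; apply: contra ii0 => /eqP ji'.
    by apply/eqP/val_inj.
under eq_integral do rewrite EFinM.
rewrite /= ge0_integralZl//.
- by rewrite he -EFinM (bigD1 i0 (P := xpredT))//= mulrC.
- exact/measurable_EFinP/mhV.
- by move=> x _; rewrite lee_fin.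
- by rewrite lee_fin prodr_ge0.
Qed.

End ProductIntegral.

(** * A maximal inequality along a random order *)

Lemma measurable_forallb {d : measure_display} {T : measurableType d}
    (I : finType) (f : I -> T -> bool) :
  (forall i, measurable_fun [set: T] (f i)) ->
  measurable_fun [set: T] (fun x => [forall i, f i x]).
Proof.
move=> mf; apply: (measurable_fun_bool true); rewrite setTI.
rewrite (_ : _ @^-1` _ = \bigcap_(i in [set: I]) (f i @^-1` [set true])).
  apply: fin_bigcap_measurable => // i _; rewrite -[X in measurable X]setTI.
  exact: mf.
apply/seteqP; split => x /=; first by move=> /forallP fx i _; exact: fx.
by move=> fx; apply/forallP => i; exact: fx.
Qed.

Section Doob.
Local Open Scope ereal_scope.
Context {d d' : measure_display} {T : measurableType d} {S : measurableType d'}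
  {R : realType}.
Variables (P : probability T R) (n : nat) (V : 'I_n -> T -> S).
Hypothesis mV : forall i, measurable_fun [set: T] (V i).
Hypothesis indepV : forall B : 'I_n -> set S, (forall i, measurable (B i)) ->
  P (\bigcap_(i in [set: 'I_n]) (V i @^-1` B i)) = \prod_(i < n) P (V i @^-1` B i).

(* In the application V i is the pair (X_i, Y_i) and kappa replaces Y_i by a
   constant, so that events of kappa (V i) are events of X_i alone. *)
Variables (kappa : S -> S) (w : S -> R) (eta : S -> R) (rho : R -> R) (t : R).
Hypothesis mkappa : measurable_fun [set: S] kappa.
Hypothesis wkappa : forall s, w (kappa s) = w s.
Hypothesis mw : measurable_fun [set: S] w.
Hypothesis meta : measurable_fun [set: S] eta.
Hypothesis eta0 : forall s, (0 <= eta s)%R.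
Hypothesis mrho : measurable_fun [set: R] rho.
Hypothesis rho0 : forall s, (0 <= rho s)%R.
Hypothesis eta_kappa : forall i C, measurable C ->
  \int[P]_(x in V i @^-1` (kappa @^-1` C)) (eta (V i x))%:E =
  P (V i @^-1` (kappa @^-1` C)).

Let mpre i (B : set S) : measurable B -> measurable (V i @^-1` B).
Proof. by move=> mB; rewrite -[X in measurable X]setTI; exact: mV. Qed.

Let mkpre (B : set S) : measurable B -> measurable (kappa @^-1` B).
Proof. by move=> mB; rewrite -[X in measurable X]setTI; exact: mkappa. Qed.

Let metaV i : measurable_fun [set: T] (fun x => eta (V i x)).
Proof. exact: (measurableT_comp meta). Qed.

(** The information available once the indices of [A] have been visited: in the application, all the
    abscissae but only the responses of [A]. As a random tuple it turns conditioning into a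
    comparison of image measures. *)
Let collapse (A : {set 'I_n}) (x : T) : n.-tuple S :=
  [tuple if i \in A then V i x else kappa (V i x) | i < n].

Let mcollapse A : measurable_fun [set: T] (collapse A).
Proof.
apply/measurable_fun_tnthP => i.
rewrite (_ : _ \o _ = fun x => if i \in A then V i x else kappa (V i x)); last first.
  by apply/funext => x /=; rewrite tnth_mktuple.
by case: (i \in A); [exact: mV|exact: measurableT_comp].
Qed.

Let rect (B : 'I_n -> set S) : set (n.-tuple S) := [set u | forall i, B i (tnth u i)].

(** The rectangles are stable under intersection, as uniqueness of measures demands of a generating
    class. *)
Let mtuple : @measurable _ (n.-tuple S) =
  <<s [set C | exists B, (forall i, measurable (B i)) /\ C = rect B] >>.
Proof.
apply/seteqP; split.
  apply: smallest_sub; first exact: smallest_sigma_algebra.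
  move=> C; rewrite -bigcup_seq => -[i _ [B mB <-]].
  apply: sub_sigma_algebra; exists (fun j => if j == i then B else setT); split.
    by move=> j; case: ifP.
  rewrite setTI; apply/seteqP; split => u /=.
    by move=> Bu j; case: eqP => // ->.
  by move=> /(_ i); rewrite eqxx.
apply: smallest_sub; first exact: sigma_algebra_measurable.
move=> _ [B [mB ->]].
rewrite (_ : rect B = \bigcap_(i in [set: 'I_n]) ((fun u => tnth u i) @^-1` B i)).
  apply: fin_bigcap_measurable => // i _; rewrite -[X in measurable X]setTI.
  exact: measurable_tnth.
by apply/seteqP; split => u /= Bu i; [move=> _|]; exact: Bu.
Qed.

Let int_eta i : \int[P]_x (eta (V i x))%:E = 1.
Proof.
by have := eta_kappa i setT measurableT; rewrite !preimage_setT probability_setT.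
Qed.

(** By independence both integrals factor over [i]. The factors could differ only outside [A], where
    the constraint bears on [kappa (V i)] and [eta] has mean one given it. *)
Let int_rect (A : {set 'I_n}) B : (forall i, measurable (B i)) ->
  exists e : 'I_n -> R,
  \int[P]_(x in collapse A @^-1` rect B) (\prod_(i in A) eta (V i x))%:E =
    (\prod_(i < n) e i)%:E /\
  \int[P]_(x in collapse A @^-1` rect B) (\prod_(i < n) eta (V i x))%:E =
    (\prod_(i < n) e i)%:E.
Proof.
move=> mB.
pose b i s : R := \1_(B i) (if i \in A then s else kappa s).
have mb i : measurable_fun [set: S] (b i).
  rewrite /b; case: (i \in A); first exact: measurable_indic.
  by apply: measurableT_comp => //; exact: measurable_indic.
have b0 i s : (0 <= b i s)%R by rewrite /b indicE.
pose h1 i s : R := ((if i \in A then eta s else 1) * b i s)%R.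
pose h2 i s : R := (eta s * b i s)%R.
have rectE x : ((x \in collapse A @^-1` rect B)%:R = \prod_(i < n) b i (V i x))%R.
  have [xB|xB] := boolP (x \in _).
    rewrite big1// => i _; rewrite /b indicE mem_set//.
    by move: xB; rewrite inE => /(_ i); rewrite tnth_mktuple.
  have [i iB] : exists i, ~ B i (tnth (collapse A x) i).
    by apply/existsNP => xBi; move/negP: xB; apply; rewrite inE.
  move: iB; rewrite tnth_mktuple => iB.
  by rewrite (bigD1 i)//= /b indicE memNset// mul0r.
have mh2 i : measurable_fun [set: S] (h2 i) by exact: measurable_funM.
have h12 i : \int[P]_x (h1 i (V i x))%:E = \int[P]_x (h2 i (V i x))%:E.
  rewrite /h1 /h2 /b; case: (boolP (i \in A)) => // iA.
  have mkB := mpre i _ (mkpre _ (mB i)).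
  transitivity (P (V i @^-1` (kappa @^-1` B i))).
    rewrite -[X in P X]setIT -integral_indic//; apply: eq_integral => x _.
    by rewrite mul1r.
  rewrite -eta_kappa// integral_mkcond; apply: eq_integral => x _.
  rewrite patchE indicE (_ : (x \in _) = (kappa (V i x) \in B i)); last first.
    by apply/idP/idP; rewrite !inE.
  by case: ifP => _; rewrite ?mulr1 ?mulr0.
have fin2 i : \int[P]_x (h2 i (V i x))%:E \is a fin_num.
  rewrite ge0_fin_numE; last by apply: integral_ge0 => x _; rewrite lee_fin mulr_ge0.
  rewrite (@le_lt_trans _ _ 1)// ?ltry// -(int_eta i); apply: ge0_le_integral => //.
  - by move=> x _; rewrite lee_fin mulr_ge0.
  - by apply/measurable_EFinP; exact: (measurableT_comp (mh2 i)).
  - exact/measurable_EFinP.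
  - move=> x _; rewrite lee_fin /h2 ler_piMr// /b indicE.
    by case: (_ \in _).
exists (fun i => fine (\int[P]_x (h2 i (V i x))%:E)); split.
  rewrite integral_mkcond.
  transitivity (\int[P]_x (\prod_(i < n) h1 i (V i x))%:E).
    apply: eq_integral => x _; rewrite patchE big_split/= -rectE -big_mkcond/=.
    by case: ifP => _; rewrite ?mulr1 ?mulr0.
  apply: integral_prod_indep => //.
  - move=> i; by apply: measurable_funM => //; case: (i \in A).
  - by move=> i s; rewrite mulr_ge0//; case: ifP.
  - by move=> i; rewrite h12 fineK.
rewrite integral_mkcond.
transitivity (\int[P]_x (\prod_(i < n) h2 i (V i x))%:E).
  apply: eq_integral => x _; rewrite patchE big_split/= -rectE.
  by case: ifP => _; rewrite ?mulr1 ?mulr0.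
apply: integral_prod_indep => //.
- by move=> i s; rewrite mulr_ge0.
- by move=> i; rewrite fineK.
Qed.

Let mprodA (A : pred 'I_n) : measurable_fun [set: T] (fun x => \prod_(i < n | A i) eta (V i x))%R.
Proof.
under eq_fun do rewrite -big_filter.
by apply: measurable_prod => i _.
Qed.

Let prodA0 (A : pred 'I_n) x : (0 <= \prod_(i < n | A i) eta (V i x))%R.
Proof. exact: prodr_ge0. Qed.

(** The martingale property between [A] and the full index set: given [collapse A], the ratios not
    yet visited integrate to one. *)
Let int_tilt (A : {set 'I_n}) (F : n.-tuple S -> R) :
  measurable_fun [set: n.-tuple S] F -> (forall u, 0 <= F u)%R ->
  \int[P]_x (\prod_(i in A) eta (V i x) * F (collapse A x))%:E =
  \int[P]_x (\prod_(i < n) eta (V i x) * F (collapse A x))%:E.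
Proof.
move=> mF F0; apply: eq_integral_comp => // C mC.
pose m1 : {measure set (n.-tuple S) -> \bar R} :=
  pushforward (density P _ (mprodA (fun i => i \in A)) (prodA0 (fun i => i \in A))) (collapse A).
pose m2 : {measure set (n.-tuple S) -> \bar R} :=
  pushforward (density P _ (mprodA xpredT) (prodA0 xpredT)) (collapse A).
apply: (@measure_unique _ _ _ _ (fun=> setT) mtuple _ _ _ (m1 (mcollapse A)) (m2 (mcollapse A))) => //.
- move=> _ _ [B [mB ->]] [B' [mB' ->]]; exists (fun i => B i `&` B' i); split.
    by move=> i; exact: measurableI.
  apply/seteqP; split => u /=; first by move=> [Bu B'u] i; split.
  by move=> Bu; split => i; have [] := Bu i.
- by move=> _; exists (fun=> setT); split => //; apply/seteqP; split.
- by apply/seteqP; split => // u _; exists 0%N.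
- by move=> _ [B [mB ->]]; have [e [e1 e2]] := int_rect A B mB; exact: etrans e1 (esym e2).
- move=> _; rewrite (_ : setT = rect (fun=> setT)); last by apply/seteqP; split.
  have [e [e1 _]] := int_rect A (fun=> setT) (fun=> measurableT).
  by rewrite [m1 _ _]e1 ltry.
Qed.

(** The initial segments of the order of the [w (v i)] that reach the level [t] at least. The strict
    inequality keeps tied indices together, so these segments form a chain. *)
Definition lower_set (A : {set 'I_n}) (v : 'I_n -> S) : bool :=
  [forall i, (w (v i) <= t)%R ==> (i \in A)] &&
  [forall i, forall j, (i \in A) && (j \notin A) ==> (w (v i) < w (v j))%R].

Definition crosses (A : {set 'I_n}) (v : 'I_n -> S) : bool :=
  (1 <= \prod_(i < n) rho (w (v i)) * \prod_(i in A) eta (v i))%R.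

(** On a chain, least cardinality means earliest. *)
Let first_cross (A : {set 'I_n}) (v : 'I_n -> S) : bool :=
  [&& lower_set A v, crosses A v &
      [forall B : {set 'I_n}, (#|B| < #|A|)%N ==> lower_set B v ==> ~~ crosses B v]].

Let measurable_imply {d1} {T1 : measurableType d1} (f g : T1 -> bool) :
  measurable_fun [set: T1] f -> measurable_fun [set: T1] g ->
  measurable_fun [set: T1] (fun x => f x ==> g x).
Proof.
move=> mf mg; under eq_fun do rewrite implybE.
by apply: measurable_or => //; exact: measurable_neg.
Qed.

Let mlower {d1} {T1 : measurableType d1} (g : 'I_n -> T1 -> S) A :
  (forall i, measurable_fun [set: T1] (g i)) ->
  measurable_fun [set: T1] (fun x => lower_set A (g^~ x)).
Proof.
move=> mg; have mwg i : measurable_fun [set: T1] (fun x => w (g i x)).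
  exact: measurableT_comp.
apply: measurable_and; apply: measurable_forallb => i.
  by apply: measurable_imply => //; exact: measurable_fun_ler.
apply: measurable_forallb => j; apply: measurable_imply => //.
exact: measurable_fun_ltr.
Qed.

Let mcrosses {d1} {T1 : measurableType d1} (g : 'I_n -> T1 -> S) A :
  (forall i, measurable_fun [set: T1] (g i)) ->
  measurable_fun [set: T1] (fun x => crosses A (g^~ x)).
Proof.
move=> mg; apply: measurable_fun_ler => //; apply: measurable_funM.
  by apply: measurable_prod => i _; do 2 apply: measurableT_comp => //.
under eq_fun do rewrite -big_filter.
by apply: measurable_prod => i _; apply: measurableT_comp.
Qed.

Let mfirst {d1} {T1 : measurableType d1} (g : 'I_n -> T1 -> S) A :
  (forall i, measurable_fun [set: T1] (g i)) ->
  measurable_fun [set: T1] (fun x => first_cross A (g^~ x)).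
Proof.
move=> mg; apply: measurable_and; first exact: mlower.
apply: measurable_and; first exact: mcrosses.
apply: measurable_forallb => B; apply: measurable_imply => //.
by apply: measurable_imply; [exact: mlower|apply: measurable_neg; exact: mcrosses].
Qed.

Let lower_total A B v : lower_set A v -> lower_set B v -> (#|B| <= #|A|)%N -> B \subset A.
Proof.
move=> /andP[_ /forallP lA] /andP[_ /forallP lB] BA; apply/fintype.subsetP => i iB.
apply/negPn/negP => iA.
have [AB|/fintype.subsetPn[j jA jB]] := boolP (A \subset B).
  by move: iA; rewrite (_ : A = B) ?iB//; apply/eqP; rewrite eqEcard AB.
have /forallP/(_ i) := lA j; rewrite jA iA/= => ji.
have /forallP/(_ j) := lB i; rewrite iB jB/= => ij.
by have := lt_trans ij ji; rewrite ltxx.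
Qed.

Let first_uniq A B v : first_cross A v -> first_cross B v -> A = B.
Proof.
wlog BA : A B / (#|B| <= #|A|)%N => [hw|] fA fB.
  have [BA|/ltnW AB] := leqP #|B| #|A|; first exact: hw.
  by apply/esym/hw.
have /and3P[lA cA /forallP/(_ B)] := fA; have /and3P[lB cB _] := fB.
rewrite lB cB/= implybF -leqNgt => AB.
by apply/eqP; rewrite eq_sym eqEcard AB andbT (lower_total A B v).
Qed.

(** The stopping time property. A lower set of smaller cardinality is a subset of [A], and [kappa]
    preserves [w]; so nothing outside [A] is consulted beyond the order. *)
Let first_collapse A x :
  first_cross A (tnth (collapse A x)) = first_cross A (V^~ x).
Proof.
have ww i : w (tnth (collapse A x) i) = w (V i x).
  by rewrite tnth_mktuple; case: ifP.
have lE B : lower_set B (tnth (collapse A x)) = lower_set B (V^~ x).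
  rewrite /lower_set; congr andb; apply: eq_forallb => i; first by rewrite ww.
  by apply: eq_forallb => j; rewrite !ww.
have cE (B : {set 'I_n}) : B \subset A ->
    crosses B (tnth (collapse A x)) = crosses B (V^~ x).
  move=> /fintype.subsetP BA; rewrite /crosses; congr (_ <= _ * _)%R.
    by apply: eq_bigr => i _; rewrite ww.
  by apply: eq_bigr => i /BA iA; rewrite tnth_mktuple iA.
rewrite /first_cross lE cE//; case lA: lower_set => //=; congr andb.
apply: eq_forallb => B; have [BA|//] := boolP (#|B| < #|A|)%N.
rewrite lE /=; case lB: lower_set => //=; rewrite cE//.
exact: (lower_total A B (V^~ x)) (ltnW BA).
Qed.

Let mbR {d1} {T1 : measurableType d1} (f : T1 -> bool) :
  measurable_fun [set: T1] f -> measurable_fun [set: T1] (fun x => (f x)%:R : R).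
Proof.
move=> mf; rewrite (_ : (fun _ => _) = fun x => if f x then 1%R else 0%R).
  exact: measurable_fun_ifT.
by apply/funext => x; case: (f x).
Qed.

Lemma measurable_crossing :
  measurable [set x | exists A, lower_set A (V^~ x) && crosses A (V^~ x)].
Proof.
rewrite (_ : [set x | _] = ~` ((fun x => [forall A, ~~ (lower_set A (V^~ x) && crosses A (V^~ x))]) @^-1` [set true])).
  apply: measurableC; rewrite -[X in measurable X]setTI.
  apply: measurable_forallb => // A; apply: measurable_neg.
  by apply: measurable_and; [exact: mlower|exact: mcrosses].
apply/seteqP; split => x /=.
  by move=> [A lc] /forallP/(_ A); rewrite lc.
by move/negP; rewrite negb_forall => /existsP[A]; rewrite negbK => ?; exists A.
Qed.

(* Given the ordering variables, the products of [eta] along the order form a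
   martingale; stop it at its first crossing. *)
Lemma doob_crossing (e : 'I_n -> R) :
  (forall i, \int[P]_x (rho (w (V i x)))%:E = (e i)%:E) ->
  P [set x | exists A, lower_set A (V^~ x) && crosses A (V^~ x)] <=
  (\prod_(i < n) e i)%:E.
Proof.
move=> he; set E := [set x | _].
have mE : measurable E by exact: measurable_crossing.
pose Phi (v : 'I_n -> S) := (\prod_(i < n) rho (w (v i)))%R.
have Phi0 v : (0 <= Phi v)%R by exact: prodr_ge0.
have mPhi d1 (T1 : measurableType d1) (g : 'I_n -> T1 -> S) :
    (forall i, measurable_fun [set: T1] (g i)) ->
    measurable_fun [set: T1] (fun x => Phi (g^~ x)).
  by move=> mg; apply: measurable_prod => i _; do 2 apply: measurableT_comp => //.
pose F A (v : 'I_n -> S) := ((first_cross A v)%:R * Phi v)%R.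
have F0 A v : (0 <= F A v)%R by rewrite mulr_ge0.
have mF d1 (T1 : measurableType d1) (g : 'I_n -> T1 -> S) A :
    (forall i, measurable_fun [set: T1] (g i)) ->
    measurable_fun [set: T1] (fun x => F A (g^~ x)).
  by move=> mg; apply: measurable_funM; [apply: mbR; exact: mfirst|exact: mPhi].
have Fc A x : F A (tnth (collapse A x)) = F A (V^~ x).
  rewrite /F first_collapse; congr (_ * _)%R; apply: eq_bigr => i _.
  by rewrite tnth_mktuple; case: ifP => // _; rewrite wkappa.
have mprodF B A : measurable_fun [set: T]
    (fun x => (\prod_(i < n | B i) eta (V i x) * F A (V^~ x))%:E).
  by apply/measurable_EFinP; apply: measurable_funM; [exact: mprodA|exact: mF].
have prodF0 B A x : 0 <= (\prod_(i < n | B i) eta (V i x) * F A (V^~ x))%:E.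
  by rewrite lee_fin mulr_ge0.
apply: (@le_trans _ _ (\sum_(A : {set 'I_n})
    \int[P]_x (\prod_(i in A) eta (V i x) * F A (V^~ x))%:E)).
  rewrite -ge0_integral_sum// -[X in P X]setIT -integral_indic//.
  apply: ge0_le_integral => //.
  - by apply/measurable_EFinP; exact: measurable_indic.
  - by apply: emeasurable_sum.
  move=> x _; rewrite indicE; have [|_] := boolP (x \in E); last first.
    exact: sume_ge0.
  rewrite inE => -[A0 A0x].
  (* A crossing lower set of least cardinality is a first crossing, and its summand is at least
     1. *)
  pose Q k := `[< exists A : {set 'I_n},
     #|A| = k /\ lower_set A (V^~ x) && crosses A (V^~ x) >].
  have exQ : exists k, Q k by exists #|A0|; apply/asboolP; exists A0.
  have [k /asboolP[A [Ak Ax]] kmin] := ex_minnP exQ.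
  have fA : first_cross A (V^~ x).
    move: Ax => /andP[lA cA]; rewrite /first_cross lA cA/=.
    apply/forallP => B; apply/implyP => BA; apply/implyP => lB.
    apply/negP => cB; move: BA; rewrite Ak ltnNge => /negP; apply; apply: kmin.
    by apply/asboolP; exists B; rewrite lB cB.
  rewrite (bigD1 A)//=; apply: (@le_trans _ _
      (\prod_(i in A) eta (V i x) * F A (V^~ x))%:E); last first.
    by rewrite leeDl// sume_ge0.
  by rewrite lee_fin /F fA mul1r mulrC; move: Ax => /andP[].
(* As [F A] depends on [collapse A] only, the missing ratios can be inserted; all summands then
   carry the same weight. *)
apply: (@le_trans _ _ (\sum_(A : {set 'I_n})
    \int[P]_x (\prod_(i < n) eta (V i x) * F A (V^~ x))%:E)).
  apply: lee_sum => A _.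
  under eq_integral do rewrite -Fc.
  under [leRHS]eq_integral do rewrite -Fc.
  rewrite (int_tilt A (fun u => F A (tnth u)))//.
  by apply: (mF _ _ (fun i u => tnth u i)) => i; exact: measurable_tnth.
rewrite -ge0_integral_sum//.
(* At most one [A] is a first crossing, so the indicators add up to at most 1. *)
apply: (@le_trans _ _ (\int[P]_x (\prod_(i < n) (rho (w (V i x)) * eta (V i x)))%:E)).
  apply: ge0_le_integral => //.
  - by move=> x _; exact: sume_ge0.
  - exact: emeasurable_sum.
  - apply/measurable_EFinP; apply: measurable_prod => i _.
    by apply: measurable_funM => //; do 2 apply: measurableT_comp => //.
  move=> x _; rewrite sumEFin lee_fin -mulr_sumr big_split/= mulrC.
  rewrite ler_wpM2r ?prodr_ge0//.
  have [[A fA]|nf] := pselect (exists A, first_cross A (V^~ x)).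
    rewrite (bigD1 A)//= big1 ?addr0; first by rewrite /F fA mul1r.
    move=> B BA; rewrite /F; case fB : first_cross; last by rewrite mul0r.
    by move: BA; rewrite (first_uniq _ _ _ fA fB) eqxx.
  rewrite big1 ?prodr_ge0// => B _; rewrite /F; case fB : first_cross; last by rewrite mul0r.
  by exfalso; apply: nf; exists B.
rewrite (integral_prod_indep P n V mV indepV (fun i s => rho (w s) * eta s)%R e)//.
- move=> i; apply: measurable_funM => //.
  by apply: measurableT_comp.
- by move=> i s; rewrite mulr_ge0.
move=> i; rewrite -he.
(* Since [rho] sees [V i] only through [kappa], the ratio integrates out. *)
transitivity (\int[P]_x (eta (V i x) * rho (w (kappa (V i x))))%:E).
  by apply: eq_integral => x _; rewrite wkappa mulrC.
rewrite (@eq_integral_comp _ _ _ _ _ P (kappa \o V i) _ (cst 1%R) (rho \o w))//.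
- by apply: eq_integral => x _; rewrite mul1r /= wkappa.
- exact: measurableT_comp.
- exact: measurableT_comp.
- by move=> s /=.
- move=> C mC; rewrite [RHS](_ : _ = \int[P]_(x in (kappa \o V i) @^-1` C) cst 1 x)//.
  rewrite integral_cst ?mul1e; last exact: mpre (mkpre _ mC).
  exact: eta_kappa.
Qed.

End Doob.

(** * Likelihood ratios from the exponential moment condition *)

Section Centered.
Local Open Scope ereal_scope.
Context {d : measure_display} {T : measurableType d} {R : realType}.
Variables (P : probability T R) (X : T -> R).
Hypothesis mX : measurable_fun [set: T] X.

(* E(U | X) = 0, without a version of the conditional expectation *)
Definition centered (U : T -> R) : Prop :=
  P.-integrable setT (EFin \o U) /\
  forall B : set R, measurable B -> \int[P]_(x in X @^-1` B) (U x)%:E = 0.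

Let mpre (B : set R) : measurable B -> measurable (X @^-1` B).
Proof. by move=> mB; rewrite -[Y in measurable Y]setTI; exact: mX. Qed.

Lemma centeredD U V : centered U -> centered V -> centered (U \+ V)%R.
Proof.
move=> [iU U0] [iV V0]; split; first exact: (integrableD measurableT iU iV).
move=> B mB; have mXB := mpre B mB.
have sub D : measurable D -> forall W : T -> R, P.-integrable setT (EFin \o W) ->
    P.-integrable D (EFin \o W).
  by move=> mD W iW; exact: (integrableS measurableT mD _ iW).
rewrite [LHS](integralD_EFin mXB (sub _ mXB _ iU) (sub _ mXB _ iV)).
by rewrite /= U0// V0// adde0.
Qed.

Lemma centeredZ k U : centered U -> centered (fun x => k * U x)%R.
Proof.
move=> [iU U0]; split; first exact: (integrableZl measurableT k iU).
move=> B mB; have mXB := mpre B mB.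
rewrite [LHS](integralZl mXB (integrableS measurableT mXB _ iU) k)//.
by rewrite U0// mule0.
Qed.

(** A version [g] is Borel on [0, 1] only and obeys its bound only almost surely. Truncation at [c],
    with value [c] off [0, 1], changes [g (X x)] on a null set and gives a Borel function bounded
    everywhere. *)
Lemma is_cond_exp_centered W g c : (forall x, X x \in `[0, 1]%R) ->
  is_cond_exp P W X g -> {ae P, forall x, (g (X x) <= c)%R} ->
  exists g' : R -> R, [/\ measurable_fun [set: R] g', forall u, (g' u <= c)%R,
    (forall u, u \in `[0, 1]%R -> (g u <= c)%R -> g' u = g u) &
    centered (fun x => W x - g' (X x))%R].
Proof.
move=> X01 [iW mg ig WgB] gc.
pose g' u := if u \in `[0, 1]%R then Num.min (g u) c else c.
have mg' : measurable_fun [set: R] g'.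
  apply: measurable_fun_if => //.
  - under eq_fun do rewrite in_itv/=.
    by apply: measurable_and; exact: measurable_fun_ler.
  - apply: measurable_minr => //; apply: (measurable_funS _ _ mg) => //.
have eqg : ae_eq P setT (EFin \o (g' \o X)) (EFin \o (g \o X)).
  apply: filterS gc => x /= gxc _; rewrite /g' X01; congr EFin.
  by apply/min_idPl.
have mgX : measurable_fun setT (EFin \o (g \o X)) by exact: measurable_int ig.
have mg'X : measurable_fun setT (EFin \o (g' \o X)).
  by apply/measurable_EFinP; exact: measurableT_comp.
have ig' : P.-integrable setT (EFin \o (g' \o X)).
  apply/integrableP; split => //.
  rewrite (ae_eq_integral (fun x => `|(EFin \o (g \o X)) x|))//; last 3 first.
  - exact: measurableT_comp.
  - exact: measurableT_comp.
  - by apply: filterS eqg => x xg Tx; rewrite xg.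
  by have /integrableP[] := ig.
exists g'; split => //.
- by move=> u; rewrite /g'; case: ifP => // _; rewrite ge_min lexx orbT.
- by move=> u u01 uc; rewrite /g' u01; apply/min_idPl.
split; first exact: (integrableB measurableT iW ig').
move=> B mB; have mXB := mpre B mB.
have sub D : measurable D -> forall W : T -> R, P.-integrable setT (EFin \o W) ->
    P.-integrable D (EFin \o W).
  by move=> mD V iV; exact: (integrableS measurableT mD _ iV).
rewrite [LHS](integralB_EFin mXB (sub _ mXB _ iW) (sub _ mXB _ ig')).
rewrite [X in X - _]WgB// (ae_eq_integral (EFin \o (g \o X)))//; last 3 first.
- exact: measurable_funTS.
- exact: measurable_funTS.
- by apply: filterS eqg => x xg Bx; exact: xg.
by rewrite subee// (integrable_fin_num mXB (sub _ mXB _ ig)).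
Qed.

Lemma integral_tilt U (B' B : set R) : centered U -> measurable B' -> measurable B ->
  \int[P]_(x in X @^-1` B) (1 + (X x \in B')%:R * U x)%:E = P (X @^-1` B).
Proof.
move=> [iU U0] mB' mB; have mXB := mpre B mB; have mXB' := mpre B' mB'.
have iV : P.-integrable (X @^-1` B) (EFin \o (fun x => (X x \in B')%:R * U x)%R).
  apply: (integrableS measurableT) => //.
  rewrite (_ : _ \o _ = (EFin \o U) \_ (X @^-1` B')).
    apply/(integrable_restrict P mXB' measurableT).
    by rewrite setTI; apply: integrableS iU.
  apply/funext => x; rewrite patchE /= (_ : (X x \in B') = (x \in X @^-1` B')).
    by case: ifP; rewrite ?mul1r ?mul0r.
  by apply/idP/idP; rewrite !inE.
have i1 : P.-integrable (X @^-1` B) (EFin \o cst 1%R).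
  apply: (integrableS measurableT) => //.
  exact: finite_measure_integrable_cst.
rewrite [LHS](integralD_EFin mXB i1 iV) /=.
rewrite [Y in Y + _](_ : _ = \int[P]_(x in X @^-1` B) cst 1 x)// integral_cst// mul1e.
rewrite [Y in _ + Y](_ : _ = 0) ?adde0//.
rewrite -(U0 (B' `&` B)); last exact: measurableI.
rewrite preimage_setI setIC integral_mkcondr; apply: eq_integral => x _.
rewrite patchE (_ : (X x \in B') = (x \in X @^-1` B')).
  by case: ifP; rewrite ?mul1r ?mul0r.
by apply/idP/idP; rewrite !inE.
Qed.
End Centered.

Section ExpBounds.
Context {R : realType}.
Implicit Types x e theta : R.

(** From exp x - 1 <= x exp x = x + x (exp x - 1), where the last product is at most x^2 exp x for x
    >= 0 and at most x^2 for x <= 0. *)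
Lemma expR_le_quad x : expR x <= 1 + x + x ^+ 2 * expR `|x|.
Proof.
have h : expR x - 1 <= x * expR x.
  have := expR_ge1Dx (- x); rewrite expRN => h.
  have ex := expR_gt0 x.
  have : (1 - x) * expR x <= 1.
    by rewrite -ler_pdivlMr// mul1r.
  lra.
have [x0|x0] := leP 0 x.
  rewrite (ger0_norm x0).
  have : x * (expR x - 1) <= x * (x * expR x) by exact: ler_wpM2l.
  rewrite expr2; lra.
have ex : 1 <= expR `|x| by rewrite -expR0 ler_expR.
have hx := expR_ge1Dx x.
have : x * (expR x - 1) <= x * x by apply: ler_wnM2l; [exact: ltW|lra].
have : x ^+ 2 * 1 <= x ^+ 2 * expR `|x| by rewrite ler_wpM2l// sqr_ge0.
rewrite expr2; lra.
Qed.

(** The linear term is kept exact because it will be centered; the remainder is reduced to the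
    exponential moments at 2 and -2, whence the constant K exp (4 alpha). *)
Lemma expR_le_cosh theta e : `|theta| <= 1 ->
  expR (theta * e) <=
  1 + theta * e + 2 * theta ^+ 2 * (expR (2 * e) + expR (- (2 * e))).
Proof.
move=> th1; apply: (le_trans (expR_le_quad _)); rewrite lerD2l exprMn.
rewrite -[leLHS]mulrA (mulrC 2 (theta ^+ 2)) -[leRHS]mulrA; apply: ler_wpM2l; first exact: sqr_ge0.
have e2 : e ^+ 2 <= 2 * expR `|e|.
  have := @expR_ge1Dxn R `|e| 1 (normr_ge0 _); rewrite real_normK ?num_real//.
  rewrite (_ : 2`!%:R = 2 :> R)//; lra.
have ee : expR `|theta * e| <= expR `|e|.
  by rewrite ler_expR normrM ler_piMl.
have ch : expR `|e| * expR `|e| <= expR (2 * e) + expR (- (2 * e)).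
  rewrite -expRD; have [e0|e0] := leP 0 e.
    by rewrite ger0_norm// -mulr2n mulr_natl lerDl expR_ge0.
  by rewrite ltr0_norm// -mulr2n mulNrn mulr_natl lerDr expR_ge0.
apply: (@le_trans _ _ ((2 * expR `|e|) * expR `|e|)).
  by rewrite ler_pM ?expR_ge0 ?sqr_ge0.
by rewrite -mulrA ler_pM2l.
Qed.

(** Put z = y^2 / (2 L). For theta = y / L the gain theta y is 2 z, and the loss 4 theta^2 k is at
    most z because 8 k <= L. Then exp (- z) <= 1 / (1 + z) <= 1 - z / 2, with z <= 1 by y^2 <= L. *)
Lemma mgf_rate (k L y : R) : 0 <= k -> 0 < y -> 8 * k <= L -> y <= L -> y ^+ 2 <= L ->
  0 < L ->
  expR (- (y / L * y)) * (1 + 4 * (y / L) ^+ 2 * k) <= 1 - y ^+ 2 / (4 * L).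
Proof.
move=> k0 y0 kL yL y2L L0.
pose z := y ^+ 2 / (2 * L).
have z0 : 0 <= z by rewrite divr_ge0 ?sqr_ge0// mulr_ge0// ltW.
have z1 : z <= 1.
  by rewrite /z ler_pdivrMr ?mulr_gt0// mul1r (le_trans y2L)// ler_pMl// ler1n.
have hk : 4 * (y / L) ^+ 2 * k <= z.
  rewrite /z (_ : 4 * (y / L) ^+ 2 * k = y ^+ 2 / (2 * L) * (8 * k / L)); last first.
    by field; rewrite gt_eqF.
  by rewrite ler_piMr// ler_pdivrMr// mul1r.
have hy : y / L * y = 2 * z by rewrite /z; field; rewrite gt_eqF.
rewrite hy (_ : y ^+ 2 / (4 * L) = z / 2); last by rewrite /z; field; rewrite gt_eqF.
apply: (@le_trans _ _ (expR (- (2 * z)) * expR z)).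
  by rewrite ler_pM2l ?expR_gt0// (le_trans _ (expR_ge1Dx _))// lerD2l.
rewrite -expRD (_ : - (2 * z) + z = - z); last by ring.
have ez := expR_ge1Dx z; rewrite expRN.
rewrite -[leRHS]invrK lef_pV2 ?posrE ?expR_gt0 ?invr_gt0//; last lra.
apply: (le_trans _ ez); rewrite -(ler_pM2r (_ : 0 < 1 - z / 2)); last lra.
rewrite mulVf; last by rewrite gt_eqF//; lra.
have : z * z <= z by rewrite ler_piMr.
lra.
Qed.
End ExpBounds.

(* With sigma = 1 (resp. -1) the points are visited from left to right (resp.
   right to left), and the excess over y of the signed errors to the right of s
   is nonnegative at some level at or after t. *)
Definition bad_event {R : realType} {T : Type} (Zs : nat -> T -> R * R)
    (mu : R -> R) (n : nat) (sigma s t y : R) : set T :=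
  [set x | exists A : {set 'I_n},
    lower_set n (fun z : R * R => sigma * z.1) t A (fun i => Zs i x) /\
    0 <= \sum_(i in A | s < sigma * (Zs i x).1)
           (sigma * ((Zs i x).2 - mu (Zs i x).1) - y)].

(** * Exponential tail of the bad event, ties and exponential moments *)

Section Tail.
Local Open Scope ereal_scope.
Context {R : realType} {d : measure_display} {T : measurableType d}.
Variables (f : R -> R) (c C K alpha A3 : R).
Hypothesis mf : measurable_fun (`[0%R, 1%R]%classic : set R) f.
Hypothesis c0 : (0 < c)%R.
Hypothesis fcC : forall x, x \in `[0%R, 1%R] -> (c <= f x <= C)%R.
Hypothesis K0 : (0 < K)%R.
Variables (P : probability T R) (Z : {mfun T >-> (R * R)%type})
  (Zs : nat -> {mfun T >-> (R * R)%type}) (mu : R -> R).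
Hypothesis Z01 : forall x, (Z x).1 \in `[0%R, 1%R].
Hypothesis Zs01 : forall i x, (Zs i x).1 \in `[0%R, 1%R].
Hypothesis muA3 : forall u, u \in `[0%R, 1%R] -> (`|mu u| <= A3)%R.
Hypothesis model : regression_model P f K alpha mu Z Zs.

Let K' : R := (K * expR (4 * alpha))%R.

Let K'0 : (0 <= K')%R. Proof. by rewrite mulr_ge0 ?expR_ge0// ltW. Qed.

Let mX : measurable_fun [set: T] (fun x => (Z x).1).
Proof. by apply: measurableT_comp. Qed.

Lemma integral_sample i (F : R * R -> \bar R) : measurable_fun [set: R * R] F ->
  (forall z, 0 <= F z) -> \int[P]_x F (Zs i x) = \int[P]_x F (Z x).
Proof.
move=> mF F0; have [_ same _ _ _] := model.
rewrite -[LHS](ge0_integral_distribution (Zs i) mF F0).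
rewrite -[RHS](ge0_integral_distribution Z mF F0).
by apply: eq_measure_integral => B mB _; exact: same.
Qed.

Lemma prob_sample i (B : set (R * R)) : measurable B -> P (Zs i @^-1` B) = P (Z @^-1` B).
Proof. by move=> mB; have [_ same _ _ _] := model; exact: same. Qed.

Lemma sample_indep n (B : 'I_n -> set (R * R)) : (forall i, measurable (B i)) ->
  P (\bigcap_(i in [set: 'I_n]) (Zs i @^-1` B i)) = \prod_(i < n) P (Zs i @^-1` B i).
Proof.
move=> mB; have [indep _ _ _ _] := model.
pose B' (i : nat) := if insub i is Some j then B j else setT.
have B'E (i : 'I_n) : B' i = B i by rewrite /B' valK.
have mB' i : measurable (B' i) by rewrite /B'; case: insubP.
rewrite (_ : \bigcap_(_ in _) _ = \bigcap_(i < n) (Zs i @^-1` B' i)).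
  by rewrite indep//; apply: eq_bigr => i _; rewrite B'E.
apply/seteqP; split => x /= h i.
  by move=> /= lin; have := h (Ordinal lin) I; rewrite -B'E.
by move=> _; rewrite /= -B'E; exact: (h i (ltn_ord i)).
Qed.

Lemma prob_X_itv (a b : R) (l r : bool) : (0 <= a)%R -> (b <= 1)%R -> (a <= b)%R ->
  (c * (b - a))%:E <= P [set x | (Z x).1 \in Interval (BSide l a) (BSide r b)]
  <= (C * (b - a))%:E.
Proof.
move=> a0 b1 ab; have [_ _ dens _ _] := model.
set I := Interval _ _.
have I01 : [set` I] `<=` `[0%R, 1%R]%classic.
  move=> u /=; rewrite /I !in_itv/= => /andP[au ub].
  by rewrite (le_trans a0 (lteifW au)) (le_trans (lteifW ub) b1).
have lI : lebesgue_measure ([set` I] : set R) = (b - a)%:E.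
  rewrite lebesgue_measure_itv /= lte_fin; case: ltP => // ba.
  by rewrite (_ : b = a) ?subrr//; apply/le_anti/andP.
have mI : measurable ([set` I] : set R) by [].
have mfI : measurable_fun ([set` I] : set R) (EFin \o f).
  by apply/measurable_EFinP; exact: (measurable_funS _ I01 mf).
rewrite (_ : [set x | _] = (fun x => (Z x).1) @^-1` [set` I])//.
rewrite dens// setIidl// !EFinM -lI.
have f0 u : [set` I] u -> (0 <= f u)%R.
  by move=> /I01 /= u01; have /andP[+ _] := fcC u u01; apply: le_trans; exact: ltW.
rewrite -!integral_cst//; apply/andP; split; apply: ge0_le_integral => //.
- by move=> u _; rewrite lee_fin ltW.
- by move=> u Iu; have /andP[+ _] := fcC u (I01 _ Iu); rewrite lee_fin.
- by move=> u Iu; have /andP[_ +] := fcC u (I01 _ Iu); rewrite lee_fin.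
Qed.

(* A likelihood ratio with conditional mean 1 given X, which dominates
   the exponential of the signed error, up to a constant factor. *)
Let tilt (sigma s theta : R) : sigma = 1%R \/ sigma = (-1)%R -> (`|theta| <= 1)%R ->
  exists eta : R * R -> R, [/\ measurable_fun [set: R * R] eta,
    forall z, (0 <= eta z)%R,
    forall z, (sigma * z.1 <= s)%R -> eta z = 1%R,
    forall z, z.1 \in `[0%R, 1%R] -> (s < sigma * z.1)%R ->
      (expR (theta * (sigma * (z.2 - mu z.1))) <= eta z * (1 + 4 * theta ^+ 2 * K'))%R &
    forall B : set R, measurable B ->
      \int[P]_(x in (fun x => (Z x).1) @^-1` B) (eta (Z x))%:E =
      P ((fun x => (Z x).1) @^-1` B)].
Proof.
move=> hsigma th1; have [_ _ _ ceY cexp] := model.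
have [] := @is_cond_exp_centered _ _ _ P _ mX _ _ A3 Z01 ceY.
  by apply: nearW => x; exact: le_trans (ler_norm _) (muA3 _ (Z01 x)).
move=> m' [mm' _ m'E ctY].
have {}m'E u : u \in `[0%R, 1%R] -> m' u = mu u.
  by move=> u01; apply: m'E => //; exact: le_trans (ler_norm _) (muA3 _ u01).
have ctexp (k : R) : (k ^+ 2 = 4)%R -> exists g : R -> R,
    [/\ measurable_fun [set: R] g, forall u, (g u <= K')%R &
    centered P (fun x => (Z x).1) (fun x => expR (k * ((Z x).2 - m' (Z x).1)) - g (Z x).1)%R].
  move=> k2; have [g [ceg gK]] := cexp k.
  have [] := @is_cond_exp_centered _ _ _ P _ mX _ _ K' Z01 ceg.
    by apply: filterS gK => x; rewrite k2.
  move=> g' [mg' g'K _ ctg]; exists g'; split => //.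
  rewrite (_ : (fun x => _ - _)%R =
    (fun x => expR (k * ((Z x).2 - mu (Z x).1)) - g' (Z x).1)%R)//.
  by apply/funext => x; rewrite m'E.
have [g2 [mg2 g2K ctg2]] := ctexp 2%R ltac:(ring).
have [gm [mgm gmK ctgm]] := ctexp (-2)%R ltac:(ring).
pose D := (1 + 4 * theta ^+ 2 * K')%R.
have D0 : (0 < D)%R.
  by rewrite ltr_pwDl// mulr_ge0// mulr_ge0// sqr_ge0.
pose eps z : R := (z.2 - m' z.1)%R.
(* Multiplied by [D], 1 + U is the bound of [expR_le_cosh] plus 2 theta^2 (2 K' - g2 - gm), which is
   nonnegative. Dividing by [D] leaves the constant term 1, hence conditional mean one. *)
pose U z := (theta / D * (sigma * eps z) +
  (2 * theta ^+ 2 / D * (expR (2 * eps z) - g2 z.1) +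
   2 * theta ^+ 2 / D * (expR (-2 * eps z) - gm z.1)))%R.
pose B' := [set u : R | (s < sigma * u)%R].
have mB' : measurable B'.
  rewrite (_ : B' = (fun u => s < sigma * u)%R @^-1` [set true]).
    rewrite -[X in measurable X]setTI; exact: measurable_fun_ltr.
  by apply/seteqP; split.
have meps : measurable_fun [set: R * R] eps.
  apply: measurable_funB; first exact: measurable_snd.
  by apply: measurableT_comp => //; exact: measurable_fst.
have mexpeps k : measurable_fun [set: R * R] (fun z => expR (k * eps z)).
  by apply: measurableT_comp => //; exact: measurable_funM.
have mU : measurable_fun [set: R * R] U.
  apply: measurable_funD; first by do 2 apply: measurable_funM => //.
  by apply: measurable_funD; apply: measurable_funM => //; apply: measurable_funB => //;
    apply: measurableT_comp => //; exact: measurable_fst.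
have ctU : centered P (fun x => (Z x).1) (fun x => U (Z x)).
  apply: (centeredD P _ mX).
    by do 2 apply: (centeredZ P _ mX); exact: ctY.
  by apply: (centeredD P _ mX); apply: (centeredZ P _ mX).
exists (fun z => 1 + (z.1 \in B')%:R * U z)%R.
have zB' z : (z.1 \in B') = (s < sigma * z.1)%R by apply/idP/idP; rewrite inE.
have key z : (s < sigma * z.1)%R ->
    (expR (theta * (sigma * eps z)) <= (1 + (z.1 \in B')%:R * U z) * D)%R.
  rewrite zB' => ->; rewrite mul1r /U.
  apply: (le_trans (expR_le_cosh _ _ th1)).
  have -> : (expR (2 * (sigma * eps z)) + expR (- (2 * (sigma * eps z))) =
     expR (2 * eps z) + expR (-2 * eps z))%R.
    by case: hsigma => ->; rewrite ?mul1r ?mulNr ?mul1r ?mulrN ?opprK// addrC.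
  rewrite [leRHS](_ : _ = D + theta * (sigma * eps z) + 2 * theta ^+ 2 *
     (expR (2 * eps z) + expR (-2 * eps z)) - 2 * theta ^+ 2 * (g2 z.1 + gm z.1))%R; last first.
    by field; rewrite gt_eqF.
  have : (2 * theta ^+ 2 * (g2 z.1 + gm z.1) <= 2 * theta ^+ 2 * (K' + K'))%R.
    by rewrite ler_wpM2l ?lerD// mulr_ge0// sqr_ge0.
  rewrite /D; lra.
split.
- apply: measurable_funD => //; apply: measurable_funM => //.
  rewrite (_ : (fun _ => _) = (fun z : R * R => \1_B' z.1))//.
  by apply: measurableT_comp; [exact: measurable_indic|exact: measurable_fst].
(* Nonnegativity follows from the domination itself: [eta] times the positive [D] is at least an
   exponential. *)
- move=> z; have [sz|sz] := boolP (z.1 \in B'); last by rewrite mul0r addr0.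
  rewrite -(pmulr_lge0 _ D0) -[X in (1 + X * _)%R]/(true%:R%R) -sz.
  apply: le_trans (key z _); first exact: expR_ge0.
  by rewrite -zB'.
- by move=> z zs; rewrite zB' ltNge zs mul0r addr0.
- by move=> z z01 sz; rewrite -/D -m'E//; exact: key.
- by move=> B mB; exact: (integral_tilt P _ mX).
Qed.
(** For a point beyond s, the exponential of theta (error - y) is at most [r * eta]. In the window
    (s, t] the factor [r] is entered in [rho]; after t the larger factor 1 is. So a bad event is a
    crossing, of probability at most (1 - (1 - r) q)^n, where the window has probability q >= c (t -
    s) and 1 - r >= y^2 / (4 L). *)
Lemma bad_event_tail (sigma s t y L : R) (n : nat) :
  sigma = 1%R /\ (0 <= s)%R /\ (t <= 1)%R \/
  sigma = (-1)%R /\ (-1 <= s)%R /\ (t <= 0)%R ->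
  (s < t)%R -> (0 < y)%R -> (8 * (K * expR (4 * alpha)) <= L)%R -> (y <= L)%R ->
  (y ^+ 2 <= L)%R -> (0 < L)%R ->
  exists E : set T, [/\ measurable E, bad_event (fun i => Zs i) mu n sigma s t y `<=` E &
    P E <= (expR (- (c / (4 * L) * (n%:R * ((t - s) * y ^+ 2)))))%:E].
Proof.
move=> hst st y0 KL yL y2L L0.
have hsigma : sigma = 1%R \/ sigma = (-1)%R by case: hst => -[->]; [left|right].
pose theta := (y / L)%R.
have th0 : (0 < theta)%R by rewrite divr_gt0.
have th1 : (`|theta| <= 1)%R by rewrite gtr0_norm// ler_pdivrMr// mul1r.
have [eta [meta eta0 eta1 etaexp etaint]] := tilt sigma s theta hsigma th1.
pose D := (1 + 4 * theta ^+ 2 * K')%R.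
have D0 : (0 < D)%R by rewrite ltr_pwDl// mulr_ge0// mulr_ge0// sqr_ge0.
pose r := (expR (- (theta * y)) * D)%R.
have r0 : (0 <= r)%R by rewrite mulr_ge0 ?expR_ge0// ltW.
have rle : (r <= 1 - y ^+ 2 / (4 * L))%R by exact: mgf_rate.
have r1 : (r <= 1)%R.
  by apply: (le_trans rle); rewrite gerBl divr_ge0 ?sqr_ge0// mulr_ge0// ltW.
pose w (z : R * R) := (sigma * z.1)%R.
pose kappa (z : R * R) := (z.1, 0%R : R).
pose rho (u : R) := if (s < u)%R && (u <= t)%R then r else 1%R.
have mw : measurable_fun [set: R * R] w.
  by apply: measurable_funM => //; exact: measurable_fst.
have mkappa : measurable_fun [set: R * R] kappa.
  by apply: measurable_fun_pair => //; exact: measurable_fst.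
have mtest : measurable_fun [set: R] (fun u : R => (s < u)%R && (u <= t)%R).
  by apply: measurable_and; [exact: measurable_fun_ltr|exact: measurable_fun_ler].
have mrho : measurable_fun [set: R] rho by exact: measurable_fun_ifT.
have rho0 u : (0 <= rho u)%R by rewrite /rho; case: ifP.
have rho1 u : (rho u <= 1)%R by rewrite /rho; case: ifP.
pose J := [set z : R * R | (s < w z)%R && (w z <= t)%R].
have mJ : measurable J.
  rewrite (_ : J = (fun z => (s < w z) && (w z <= t))%R @^-1` [set true]).
    rewrite -[X in measurable X]setTI.
    exact: (measurableT_comp mtest mw).
  by apply/seteqP; split.
have qJ : (c * (t - s))%:E <= P (Z @^-1` J).
  (* For sigma = -1 the window (s, t] of the signed abscissa is the interval [-t, -s) of X. *)
  case: hst => -[sg [h1 h2]].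
    have /andP[+ _] := prob_X_itv s t false false h1 h2 (ltW st).
    rewrite (_ : [set x | _] = Z @^-1` J)//.
    by apply/seteqP; split => x; rewrite /J /w /= sg in_itv/= mul1r.
  have /andP[+ _] := prob_X_itv (- t) (- s) true true
    ltac:(by rewrite oppr_ge0) ltac:(by rewrite lerNl) ltac:(by rewrite lerN2 ltW).
  rewrite (_ : [set x | _] = Z @^-1` J); first by rewrite opprK addrC.
  by apply/seteqP; split => x; rewrite /J /w /= sg in_itv/= mulN1r lerNl ltrNr andbC.
have mZJ i : measurable (Zs i @^-1` J).
  have mZs : measurable_fun [set: T] (Zs i) by [].
  by rewrite -[X in measurable X]setTI; exact: mZs.
have qfin : P (Z @^-1` J) \is a fin_num.
  by rewrite -(prob_sample 0)// fin_num_measure.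
pose q := fine (P (Z @^-1` J)).
have qge : (c * (t - s) <= q)%R by rewrite -lee_fin fineK.
have intrho (i : 'I_n) : \int[P]_x (rho (w (Zs i x)))%:E = (1 - (1 - r) * q)%:E.
  have mrw : measurable_fun [set: T] (fun x => rho (w (Zs i x))).
    by apply: measurableT_comp => //; exact: measurableT_comp.
  have h : \int[P]_x (rho (w (Zs i x)))%:E + ((1 - r) * q)%:E = 1.
    rewrite EFinM fineK// -(prob_sample i)// -[X in P X]setIT -integral_indic//.
    have sr0 : 0 <= (1 - r)%:E by rewrite lee_fin subr_ge0.
    have m1 : measurable_fun [set: T] (fun x => (\1_(Zs i @^-1` J) x)%:E : \bar R).
      by apply/measurable_EFinP; exact: measurable_indic.
    rewrite -ge0_integralZl//.
    rewrite -ge0_integralD//; last 4 first.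
    - by move=> x _; rewrite lee_fin.
    - exact/measurable_EFinP.
    - by move=> x _; rewrite -EFinM lee_fin mulr_ge0// subr_ge0.
    - by apply: emeasurable_funM => //; apply/measurable_EFinP; exact: measurable_indic.
    rewrite -(probability_setT P) -[RHS]mul1e -integral_cst//.
    apply: eq_integral => x _ /=; rewrite -EFinM -EFinD indicE /rho.
    have -> : (x \in Zs i @^-1` J) = (s < w (Zs i x))%R && (w (Zs i x) <= t)%R.
      by apply/idP/idP; rewrite inE.
    by case: ifP => _; rewrite ?mulr1 ?mulr0 ?addr0// addrC subrK.
  move: h; rewrite EFinB => <-; rewrite addeK//.
pose E := [set x | exists A, lower_set n w t A (fun i : 'I_n => Zs i x) &&
   crosses n w eta rho A (fun i : 'I_n => Zs i x)].
have metaV : forall (i : 'I_n) (Q : set (R * R)), measurable Q ->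
   \int[P]_(x in Zs i @^-1` (kappa @^-1` Q)) (eta (Zs i x))%:E =
   P (Zs i @^-1` (kappa @^-1` Q)).
  move=> i Q mQ.
  have mkQ : measurable (kappa @^-1` Q).
    by rewrite -[X in measurable X]setTI; exact: mkappa.
  rewrite prob_sample// integral_mkcond.
  pose F z := (\1_(kappa @^-1` Q) z * eta z)%:E.
  transitivity (\int[P]_x F (Zs i x)).
    apply: eq_integral => x _; rewrite patchE /F indicE.
    rewrite (_ : (x \in _) = (Zs i x \in kappa @^-1` Q)).
      by case: ifP => _; rewrite ?mul1r ?mul0r.
    by apply/idP/idP; rewrite !inE.
  rewrite integral_sample; last 2 first.
  - by apply/measurable_EFinP; apply: measurable_funM => //; exact: measurable_indic.
  - by move=> z; rewrite lee_fin mulr_ge0.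
  pose B := [set u : R | Q (u, 0%R)].
  have mB : measurable B.
    rewrite -[X in measurable X]setTI.
    exact: (measurable_fun_pair (@measurable_id _ R setT) (@measurable_cst _ _ R R setT 0%R)) mQ.
  rewrite -[RHS](etaint B mB) [RHS]integral_mkcond.
  apply: eq_integral => x _; rewrite patchE /F indicE.
  rewrite (_ : (x \in _) = (Z x \in kappa @^-1` Q)).
    by case: ifP => _; rewrite ?mul1r ?mul0r.
  by apply/idP/idP; rewrite !inE.
have mVn (i : 'I_n) : measurable_fun [set: T] (Zs i) by [].
exists E; split.
- exact: (measurable_crossing n (fun i : 'I_n => Zs i : T -> R * R)).
- move=> x [A [lA sumA]]; exists A; rewrite lA /crosses/=.
  (* A lower set contains every point up to [t], so [rho] is 1 outside [A]. *)
  have -> : (\prod_(i < n) rho (w (Zs i x)) = \prod_(i in A) rho (w (Zs i x)))%R.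
    rewrite (bigID (mem A))/= [X in (_ * X)%R]big1 ?mulr1// => i iA.
    rewrite /rho; case: ifP => // /andP[_ wt].
    have /andP[/forallP/(_ i)] := lA.
    by rewrite wt (negbTE iA).
  rewrite -big_split/=.
  apply: (@le_trans _ _ (expR (theta * \sum_(i in A | (s < w (Zs i x))%R)
      (sigma * ((Zs i x).2 - mu (Zs i x).1) - y)))).
    by rewrite -expR0 ler_expR mulr_ge0// ltW.
  rewrite mulr_sumr expR_sum big_mkcondr/=.
  apply: ler_prod => i iA; case: ifPn => [sw|].
    rewrite expR_ge0/=; apply: (@le_trans _ _ (r * eta (Zs i x))%R).
      rewrite mulrBr expRD [leLHS]mulrC /r -mulrA ler_pM2l ?expR_gt0//.
      rewrite [leRHS]mulrC.
      exact: (etaexp (Zs i x) (Zs01 i x) sw).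
    rewrite ler_wpM2r// /rho; by case: ifP.
  rewrite -leNgt => ws; by rewrite ler01 eta1// mulr1 /rho ltNge ws/= lexx.
apply: (le_trans (doob_crossing P n (fun i : 'I_n => Zs i : T -> R * R) mVn
  (sample_indep n) kappa w eta rho t mkappa (fun=> erefl) mw meta eta0 mrho rho0
  metaV (fun=> 1 - (1 - r) * q)%R intrho)).
rewrite lee_fin prodr_const card_ord.
have qr : (y ^+ 2 / (4 * L) * (c * (t - s)) <= (1 - r) * q)%R.
  apply: ler_pM => //.
  - by rewrite divr_ge0 ?sqr_ge0// mulr_ge0// ltW.
  - by rewrite mulr_ge0 ?subr_ge0// ltW.
  - by rewrite lerBrDr addrC -lerBrDr.
have le1 : (1 - (1 - r) * q <= expR (- (y ^+ 2 / (4 * L) * (c * (t - s)))))%R.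
  apply: le_trans (expR_ge1Dx _); rewrite lerD2l lerN2//.
rewrite [leRHS](_ : _ = expR (- (y ^+ 2 / (4 * L) * (c * (t - s)))) ^+ n)%R; last first.
  by rewrite -expRM_natl; congr expR; field; rewrite gt_eqF.
apply: lerXn2r => //; rewrite nnegrE ?expR_ge0//.
rewrite subr_ge0 mulr_ile1// ?subr_ge0//.
- by rewrite -lee_fin fineK.
- by rewrite gerBl.
- by rewrite -lee_fin fineK// -(prob_sample 0)// probability_le1.
Qed.

Lemma prob_pair (i j : nat) (B : set (R * R)) : i != j -> measurable B ->
  P ([set x | B (Zs i x)] `&` [set x | B (Zs j x)]) = P (Z @^-1` B) * P (Z @^-1` B).
Proof.
move=> ij mB; pose n := (maxn i j).+1.
have ni : (i < n)%N by rewrite ltnS leq_maxl.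
have nj : (j < n)%N by rewrite ltnS leq_maxr.
pose ii := Ordinal ni; pose jj := Ordinal nj.
pose Q (k : 'I_n) := if (k == ii) || (k == jj) then B else setT.
have := sample_indep n Q.
rewrite (_ : \bigcap_(_ in _) _ = [set x | B (Zs i x)] `&` [set x | B (Zs j x)]); last first.
  apply/seteqP; split => x /=.
    by move=> h; split; [have := h ii I|have := h jj I]; rewrite /Q ?eqxx ?orbT.
  move=> [Bi Bj] k _; rewrite /= /Q.
  by case: eqP => [->//|_]; case: eqP => [->//|_].
move=> ->; last by move=> k; rewrite /Q; case: ifP.
have jii : jj != ii by rewrite -val_eqE /= eq_sym.
rewrite (bigD1 ii)//= (bigD1 jj)//= [X in _ * (_ * X)]big1; last first.
  by move=> k /andP[ki kj]; rewrite /Q (negbTE ki) (negbTE kj) preimage_setT probability_setT.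
by rewrite mule1 /Q !eqxx orbT !prob_sample.
Qed.

(** Tied abscissae share one of m equal cells, which has probability at most m (C / m)^2 = C^2 / m,
    for every m. *)
Lemma prob_tie (i j : nat) : i != j -> P [set x | (Zs i x).1 = (Zs j x).1] = 0.
Proof.
move=> ij; apply/eqP; rewrite eq_le measure_ge0 andbT.
apply/lee_addgt0Pr => e e0; rewrite add0e.
have C0 : (0 < C)%R.
  have /fcC/andP[cC1 cC2] : (0 : R)%R \in `[0%R, 1%R] by rewrite in_itv/= lexx ler01.
  exact: lt_le_trans c0 (le_trans cC1 cC2).
pose m := (Num.truncn (C ^+ 2 / e)).+1.
have m0 : (0 < m%:R :> R)%R by rewrite ltr0n.
have mC : (C ^+ 2 / m%:R <= e)%R.
  rewrite ler_pdivrMr// mulrC -ler_pdivrMr// ltW// /m truncnS_gt//.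
pose cell k := [set z : R * R | z.1 \in `[(k%:R / m%:R)%R, (k.+1%:R / m%:R)%R]].
have mcell k : measurable (cell k).
  rewrite -[X in measurable X]setTI.
  exact: (@measurable_fst _ _ R R _ _ (measurable_itv `[(k%:R / m%:R)%R, (k.+1%:R / m%:R)%R])).
pose tie k := [set x | cell k (Zs i x)] `&` [set x | cell k (Zs j x)].
have mtie k : measurable (tie k).
  have mZs l : measurable_fun [set: T] (Zs l) by [].
  by apply: measurableI; rewrite -[X in measurable X]setTI; exact: mZs.
have mT : measurable [set x | (Zs i x).1 = (Zs j x).1].
  rewrite (_ : [set x | _] = (fun x => (Zs i x).1 == (Zs j x).1) @^-1` [set true]).
    rewrite -[X in measurable X]setTI; apply: measurable_fun_eqr => //.
      by apply: (measurableT_comp (@measurable_fst _ _ R R)).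
    by apply: (measurableT_comp (@measurable_fst _ _ R R)).
  by apply/seteqP; split => x /eqP.
apply: (@le_trans _ _ (P (\big[setU/set0]_(k < m) tie k))).
  apply: le_measure; rewrite ?inE//; first exact: bigsetU_measurable.
  move=> x /= tx; rewrite -bigcup_mkord /=.
  have x01 := Zs01 i x; have /andP[x0 x1] : (0 <= (Zs i x).1 <= 1)%R.
    by move: x01; rewrite in_itv.
  (* The cap puts the abscissa 1 in the last closed cell. *)
  pose k := minn (Num.truncn (m%:R * (Zs i x).1)) m.-1.
  have km : (k < m)%N by rewrite /k gtn_min orbC ltnSn.
  suff ck : cell k (Zs i x) by exists k => //; split => //=; rewrite /cell /= -tx.
  have mx0 : (0 <= m%:R * (Zs i x).1)%R by rewrite mulr_ge0.
  have /andP[t1 t2] := truncn_itv mx0.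
  rewrite /cell /= in_itv/= ler_pdivrMr// ler_pdivlMr// ![((Zs i x).1 * _)%R]mulrC; apply/andP; split.
    by apply: le_trans t1; rewrite ler_nat geq_minl.
  have [h|h] := leqP (Num.truncn (m%:R * (Zs i x).1)) m.-1.
    by rewrite /k (minn_idPl h) ltW.
  by rewrite /k (minn_idPr (ltnW h)) /= ler_piMr.
apply: (le_trans (Boole_inequality _ _)) => //.
apply: (@le_trans _ _ (\sum_(k < m) ((C / m%:R) ^+ 2)%:E)).
  apply: lee_sum => k _; rewrite [leLHS](prob_pair i j (cell k) ij (mcell k)) expr2 EFinM.
  have h : P (Z @^-1` cell k) <= (C / m%:R)%:E.
    have := @prob_X_itv (k%:R / m%:R)%R (k.+1%:R / m%:R)%R true false.
    rewrite divr_ge0// ler_pdivrMr// mul1r ler_nat ltn_ord ler_pM2r ?invr_gt0// ler_nat leqnSn.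
    move=> /(_ isT isT isT) /andP[_]; rewrite -mulrBl -natrB// subSnn mul1r.
    by apply: le_trans; rewrite le_eqVlt; apply/orP; left; apply/eqP; congr (P _).
  by apply: lee_pmul => //.
rewrite sumEFin lee_fin sumr_const card_ord -mulr_natl.
apply: le_trans mC; rewrite [leLHS](_ : _ = C ^+ 2 / m%:R)%R//.
by field; rewrite gt_eqF.
Qed.

Lemma exp_moment (i : nat) :
  measurable_fun [set: T] (fun x =>
    expR (2 * ((Zs i x).2 - mu (Zs i x).1)) + expR (-2 * ((Zs i x).2 - mu (Zs i x).1)))%R /\
  \int[P]_x (expR (2 * ((Zs i x).2 - mu (Zs i x).1)) +
            expR (-2 * ((Zs i x).2 - mu (Zs i x).1)))%:E
    <= (2 * K * expR (4 * alpha))%:E.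
Proof.
have [_ _ _ ceY cexp] := model.
have [] := @is_cond_exp_centered _ _ _ P _ mX _ _ A3 Z01 ceY.
  by apply: nearW => x; exact: le_trans (ler_norm _) (muA3 _ (Z01 x)).
move=> m' [mm' _ m'E _].
have {}m'E u : u \in `[0%R, 1%R] -> m' u = mu u.
  by move=> u01; apply: m'E => //; exact: le_trans (ler_norm _) (muA3 _ u01).
have meps : measurable_fun [set: R * R] (fun z : R * R => z.2 - m' z.1)%R.
  apply: measurable_funB; first exact: measurable_snd.
  by apply: measurableT_comp => //; exact: measurable_fst.
have mexp k : measurable_fun [set: R * R] (fun z : R * R => expR (k * (z.2 - m' z.1))).
  by apply: measurableT_comp => //; exact: measurable_funM.
have mZs : measurable_fun [set: T] (Zs i) by [].
have EE k : (fun x => expR (k * ((Zs i x).2 - mu (Zs i x).1))) =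
    (fun x => expR (k * ((Zs i x).2 - m' (Zs i x).1))).
  by apply/funext => x; rewrite m'E.
have mexpZ k : measurable_fun [set: T] (fun x => expR (k * ((Zs i x).2 - mu (Zs i x).1))).
  by rewrite EE; exact: (measurableT_comp (mexp k) mZs).
have bound (k : R) : (k ^+ 2 = 4)%R ->
    \int[P]_x (expR (k * ((Zs i x).2 - mu (Zs i x).1)))%:E <= K'%:E.
  move=> k2; rewrite [leLHS](_ : _ = \int[P]_x (expR (k * ((Z x).2 - mu (Z x).1)))%:E); last first.
    transitivity (\int[P]_x (expR (k * ((Zs i x).2 - m' (Zs i x).1)))%:E).
      by apply: eq_integral => x _; rewrite m'E.
    rewrite (integral_sample i (fun z : R * R => (expR (k * (z.2 - m' z.1)))%:E)); last 2 first.
    - exact/measurable_EFinP.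
    - by move=> z; rewrite lee_fin expR_ge0.
    by apply: eq_integral => x _; rewrite m'E.
  have [g [ceg gK]] := cexp k.
  have [] := @is_cond_exp_centered _ _ _ P _ mX _ _ K' Z01 ceg.
    by apply: filterS gK => x; rewrite k2.
  move=> g' [mg' g'K _ [iU U0]]; have [iW _ _ _] := ceg.
  have iK : P.-integrable setT (EFin \o cst K') by exact: finite_measure_integrable_cst.
  apply: (@le_trans _ _ (\int[P]_x ((expR (k * ((Z x).2 - mu (Z x).1)) - g' (Z x).1) + K')%:E)).
    apply: le_integral => //; first exact: (integrableD measurableT iU iK).
    by move=> x _; rewrite lee_fin -addrA lerDl addrC subr_ge0.
  rewrite [leLHS](integralD_EFin measurableT iU iK) /=.
  have := U0 _ measurableT; rewrite preimage_setT => ->; rewrite add0e.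
  rewrite [leLHS](_ : _ = \int[P]_x cst K'%:E x)// integral_cst//.
  by rewrite [X in _ * X](_ : _ = 1) ?mule1//; exact: probability_setT.
split; first exact: measurable_funD.
under eq_integral do rewrite EFinD.
rewrite ge0_integralD//; last 2 first.
- exact/measurable_EFinP.
- exact/measurable_EFinP.
apply: (@le_trans _ _ (K'%:E + K'%:E)).
  by apply: leeD; apply: bound; ring.
by rewrite -EFinD lee_fin /K'; lra.
Qed.
End Tail.

(** * Slopes of the least concave majorant *)

Section Concave.
Context {R : realType}.
Implicit Types (g h : R -> R) (a b s t u v : R).

Lemma concave01P g : concave01 g <->
  forall x y l, x \in `[0, 1] -> y \in `[0, 1] -> l \in `[0, 1] ->
    l * g x + (1 - l) * g y <= g (l * x + (1 - l) * y).
Proof.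
split=> [cg x y l x01 y01|cg l x y].
  rewrite in_itv/= => /andP[l0 l1].
  pose li : {i01 R} := Itv01 l0 l1.
  have := cg li x y; rewrite !mem_setE => /(_ x01 y01).
  by rewrite [leRHS]convRE lerNl opprD !mulrN !opprK.
rewrite !mem_setE => x01 y01.
have := cg x y l%:num x01 y01; rewrite in_itv/= ge0 le1 => /(_ isT) H.
by rewrite [leRHS]convRE lerNl opprD !mulrN !opprK.
Qed.

Lemma concave01_affine a b : concave01 (fun s => a * s + b).
Proof. by apply/concave01P => x y l _ _ _; lra. Qed.

Section Majorant.
Variables (h : R -> R) (a0 b0 : R).
Hypothesis hub : forall s, s \in `[0, 1] -> h s <= a0 * s + b0.

Let H := lc_majorant01 h.
Let majs t := [set g t | g in [set g : R -> R |
    concave01 g /\ forall s : R, s \in `[0, 1] -> h s <= g s]].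

Let majs_lb t : t \in `[0, 1] -> has_lbound (majs t).
Proof. by move=> t01; exists (h t) => _ [g [_ hg] <-]; exact: hg. Qed.

Let majs_n0 t : majs t !=set0.
Proof.
exists (a0 * t + b0); exists (fun s => a0 * s + b0) => //.
by split=> //; exact: concave01_affine.
Qed.

Lemma lc_majorant_ge t : t \in `[0, 1] -> h t <= H t.
Proof.
move=> t01; apply: lb_le_inf; first exact: majs_n0.
by move=> _ [g [_ hg] <-]; exact: hg.
Qed.

Lemma lc_majorant_le g t : concave01 g -> (forall s, s \in `[0, 1] -> h s <= g s) ->
  t \in `[0, 1] -> H t <= g t.
Proof. by move=> cg hg t01; apply: ge_inf; [exact: majs_lb|exists g]. Qed.

Lemma lc_majorant_concave x y l : x \in `[0, 1] -> y \in `[0, 1] -> l \in `[0, 1] ->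
  l * H x + (1 - l) * H y <= H (l * x + (1 - l) * y).
Proof.
move=> x01 y01 l01; apply: lb_le_inf; first exact: majs_n0.
move=> _ [g [cg hg] <-].
have [l0 l1] : 0 <= l /\ 0 <= 1 - l by move: l01; rewrite in_itv/= subr_ge0 => /andP[].
apply: le_trans ((concave01P g).1 cg x y l x01 y01 l01).
by apply: lerD; apply: ler_wpM2l => //; apply: lc_majorant_le.
Qed.

Definition slope (s v : R) := (H v - H s) / (v - s).

Lemma lc_majorant_mid u s v : 0 <= u -> u < s -> s < v -> v <= 1 ->
  (v - s) * H u + (s - u) * H v <= (v - u) * H s.
Proof.
move=> u0 us sv v1.
have vu : 0 < v - u by lra.
pose l := (v - s) / (v - u).
have l1 : 1 - l = (s - u) / (v - u) by rewrite /l; field; rewrite gt_eqF.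
have l01 : l \in `[0, 1].
  rewrite in_itv/= divr_ge0; [|lra..].
  by rewrite ler_pdivrMr// mul1r; lra.
have u01 : u \in `[0, 1] by rewrite in_itv/= u0; lra.
have v01 : v \in `[0, 1] by rewrite in_itv/= v1 andbT; lra.
have := lc_majorant_concave u v l u01 v01 l01.
rewrite l1 (_ : l * u + _ = s); last by rewrite /l; field; rewrite gt_eqF.
rewrite -(ler_pM2l vu) [leLHS](_ : _ = (v - s) * H u + (s - u) * H v)//.
by rewrite /l; field; rewrite gt_eqF.
Qed.

Lemma slope_noninc u s v : 0 <= u -> u <= s -> s < v -> v <= 1 ->
  slope s v <= slope u v.
Proof.
move=> u0; rewrite le_eqVlt => /predU1P[->//|us] sv v1.
have := lc_majorant_mid u s v u0 us sv v1 => mid.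
rewrite /slope ler_pdivrMr ?subr_gt0// mulrAC ler_pdivlMr ?subr_gt0 ?(lt_trans us)//.
by rewrite -subr_ge0; move: mid; rewrite -subr_ge0; congr (0 <= _); ring.
Qed.

Lemma slope_le_right s v w : 0 <= s -> s < v -> v <= w -> w <= 1 ->
  slope s w <= slope s v.
Proof.
move=> s0 sv; rewrite le_eqVlt => /predU1P[->//|vw] w1.
have := lc_majorant_mid s v w s0 sv vw w1 => mid.
rewrite /slope ler_pdivrMr ?subr_gt0 ?(lt_trans sv)// mulrAC ler_pdivlMr ?subr_gt0//.
by rewrite -subr_ge0; move: mid; rewrite -subr_ge0; congr (0 <= _); ring.
Qed.

Section LeftSlope.
Variables (v m : R).
Hypotheses (v0 : 0 < v) (v1 : v <= 1).
Hypothesis slopem : forall s, 0 <= s -> s < v -> m <= slope s v.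

(** [left_slope] is a [lim], informative only when the quotients converge. They are nonincreasing in
    s, and [m] excludes the limit -oo, which concavity alone allows at v = 1. *)
Let cvg_slope : cvg (slope s v @[s --> v^'-]).
Proof.
suff : cvg (- slope s v @[s --> v^'-]) by rewrite is_cvgNE.
apply: nondecreasing_at_left_is_cvgr.
  near=> x => s t; rewrite !in_itv/= => /andP[xs sv] /andP[xt tv] st.
  by rewrite lerN2 slope_noninc//; apply: le_trans (ltW xs); near: x; exact: nbhs_left_ge.
near=> x; exists (- m) => _ [s /= + <-]; rewrite in_itv/= => /andP[xs sv].
by rewrite lerN2 slopem//; apply: le_trans (ltW xs); near: x; exact: nbhs_left_ge.
Unshelve. all: by end_near. Qed.

Lemma left_slope_ge : m <= left_slope H v.
Proof.
apply: limr_ge; first exact: cvg_slope.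
near=> s; apply: slopem; near: s; [exact: nbhs_left_ge|exact: nbhs_left_lt].
Unshelve. all: by end_near. Qed.

Lemma left_slope_le u : 0 <= u -> u < v -> left_slope H v <= slope u v.
Proof.
move=> u0 uv; apply: limr_le; first exact: cvg_slope.
by near=> s; apply: slope_noninc => //; near: s; exact: nbhs_left_ge.
Unshelve. all: by end_near. Qed.
End LeftSlope.
End Majorant.
End Concave.

Section GridSlope.
Context {R : realType}.

Lemma max_range (F : nat -> R) m n : (m <= n)%N -> exists j, (m <= j <= n)%N /\
  forall i, (m <= i <= n)%N -> F i <= F j.
Proof.
elim: n => [|n IH]; first by rewrite leqn0 => /eqP ->; exists 0%N; split => // -[].
rewrite leq_eqVlt => /predU1P[->|mn].
  exists n.+1; split; first by rewrite leqnn.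
  by move=> i /andP[a b]; rewrite (_ : i = n.+1)//; apply/eqP; rewrite eqn_leq a b.
have [j [/andP[mj jn] jmax]] := IH mn.
have [FF|/ltW FF] := leP (F n.+1) (F j).
  exists j; split => [|i /andP[mi]]; first by rewrite mj leqW.
  by rewrite leq_eqVlt => /predU1P[->//|ii]; apply: jmax; rewrite mi.
exists n.+1; split => [|i /andP[mi]]; first by rewrite (ltnW mn)/=.
rewrite leq_eqVlt => /predU1P[->//|ii]; apply: le_trans FF; apply: jmax.
by rewrite mi.
Qed.

Variables (h : R -> R) (N : nat).
Hypothesis N0 : (0 < N)%N.
Hypothesis interp : forall a b : R,
  (forall j, (j <= N)%N -> h (j%:R / N%:R) <= a * (j%:R / N%:R) + b) ->
  forall s, s \in `[0, 1] -> h s <= a * s + b.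

Let H := lc_majorant01 h.
Let x (j : nat) : R := j%:R / N%:R.

Let N0R : 0 < N%:R :> R. Proof. by rewrite ltr0n. Qed.

Let x01 j : (j <= N)%N -> x j \in (`[0, 1] : interval R).
Proof.
by move=> jN; rewrite in_itv/= divr_ge0//= ler_pdivrMr// mul1r ler_nat.
Qed.

Let hub s : s \in `[0, 1] -> h s <= 0 * s + \sum_(j < N.+1) `|h (x j)|.
Proof.
apply: interp => j jN; rewrite mul0r add0r (le_trans (ler_norm _))//.
by rewrite (bigD1 (Ordinal (jN : (j < N.+1)%N)))//= lerDl sumr_ge0.
Qed.

(** The line of slope [a] through a maximiser of h - a x on the grid lies above h on the grid, hence
    on [0, 1] by [interp]. Being concave, it also lies above the majorant, and the two meet at x
    i. *)
Let touch (a : R) i : (i <= N)%N ->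
  (forall j, (j <= N)%N -> h (x j) - a * x j <= h (x i) - a * x i) ->
  H (x i) = h (x i) /\ forall s, s \in `[0, 1] -> H s <= h (x i) + a * (s - x i).
Proof.
move=> iN imax.
have Hle s : s \in `[0, 1] -> H s <= h (x i) + a * (s - x i).
  move=> s01; rewrite (_ : _ + _ = a * s + (h (x i) - a * x i)); last by ring.
  apply: (@lc_majorant_le _ h (fun s => a * s + (h (x i) - a * x i))) => //.
    exact: concave01_affine.
  by apply: interp => j jN; have := imax j jN; rewrite /x; lra.
split => //; apply/eqP; rewrite eq_le (lc_majorant_ge h _ _ hub) ?x01// andbT.
by apply: (le_trans (Hle _ (x01 _ iN))); rewrite subrr mulr0 addr0.
Qed.

Section Index.
Variable k : nat.
Hypotheses (k0 : (0 < k)%N) (kN : (k <= N)%N).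

Let v0 : 0 < x k. Proof. by rewrite divr_gt0// ltr0n. Qed.

Let v1 : x k <= 1. Proof. by have := x01 _ kN; rewrite in_itv/= => /andP[]. Qed.

(** Maximise h - a x over the indices from k on. Through l the maximiser j also beats every index
    below k, so [touch] applies at j; slopes ending at x k are at least those ending at x j, as j >=
    k. *)
Let slope_ge (a : R) l : (k <= l <= N)%N ->
  (forall i, (i < k)%N -> a * (x l - x i) <= h (x l) - h (x i)) ->
  forall s, 0 <= s -> s < x k -> a <= slope h s (x k).
Proof.
move=> /andP[kl lN] hl s s0 sv.
have [j [/andP[kj jN] jmax]] := max_range (fun j => h (x j) - a * x j) _ _ kN.
have [||Hj Hle] := touch a j => //.
  move=> i iN; have [ki|ik] := leqP k i; first by apply: jmax; rewrite ki.
  have := hl i ik; have := jmax l; rewrite kl lN => /(_ isT); lra.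
have vj : x k <= x j by rewrite ler_pM2r ?invr_gt0// ler_nat.
have j1 : x j <= 1 by have := x01 _ jN; rewrite in_itv/= => /andP[].
apply: le_trans (slope_le_right h _ _ hub s (x k) (x j) s0 sv vj j1).
rewrite /slope ler_pdivlMr ?subr_gt0 ?(lt_le_trans sv)// -/H Hj.
have /Hle : s \in `[0, 1] by rewrite in_itv/= s0 (le_trans (ltW sv)).
lra.
Qed.

Let slope_bounded : exists m : R, forall s, 0 <= s -> s < x k -> m <= slope h s (x k).
Proof.
pose M := \sum_(j < N.+1) `|h (x N) - h (x j)|.
(* Distinct grid points are at least 1 / N apart, so every grid slope ending at x N is at least - N
   M. *)
exists (- (N%:R * M)); apply: (slope_ge _ N); first by rewrite kN leqnn.
move=> i ik; have iN := leq_trans ik kN.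
have M0 : 0 <= M by rewrite sumr_ge0.
have hM : `|h (x N) - h (x i)| <= M.
  by rewrite /M (bigD1 (Ordinal (ltnW iN : (i < N.+1)%N)))//= lerDl sumr_ge0.
have : - M <= h (x N) - h (x i) by rewrite lerNl (le_trans _ hM)// -normrN ler_norm.
have hx : 1 <= N%:R * (x N - x i).
  rewrite /x -mulrBl mulrCA mulfV ?gt_eqF// mulr1 -natrB; last exact: ltnW.
  by rewrite ler1n subn_gt0.
by apply: le_trans; rewrite mulNr lerN2 mulrAC ler_peMl.
Qed.

Lemma grid_left_slope_ge (a : R) l : (k <= l <= N)%N ->
  (forall i, (i < k)%N -> a * (x l - x i) <= h (x l) - h (x i)) ->
  a <= left_slope (lc_majorant01 h) (x k).
Proof. by move=> kl hl; apply: (left_slope_ge h _ _ hub) => //; exact: slope_ge hl. Qed.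

(** Dually, a maximiser j of h - a x over the indices below k is a global one, and the left slope at
    x k is at most the slope from x j. *)
Lemma grid_left_slope_le (a : R) i : (i < k)%N ->
  (forall l, (k <= l <= N)%N -> h (x l) - h (x i) <= a * (x l - x i)) ->
  left_slope (lc_majorant01 h) (x k) <= a.
Proof.
move=> ik hi; have [m slopem] := slope_bounded.
have kk1 : (0 <= k.-1)%N by [].
have [j [/andP[_ jk] jmax]] := max_range (fun j => h (x j) - a * x j) _ _ kk1.
have {}jk : (j < k)%N by rewrite -(prednK k0).
have jN : (j <= N)%N by exact: leq_trans (ltnW jk) kN.
have [||Hj Hle] := touch a j => //.
  move=> l lN; have [kl|lk] := leqP k l; last by apply: jmax; rewrite /= -ltnS prednK.
  have := hi l; rewrite kl lN => /(_ isT).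
  have := jmax i; rewrite /= -ltnS prednK// ik => /(_ isT); lra.
have xjk : x j < x k by rewrite ltr_pM2r ?invr_gt0// ltr_nat.
have xj0 : 0 <= x j by rewrite divr_ge0.
apply: le_trans (left_slope_le h _ _ hub _ _ v0 v1 slopem (x j) xj0 xjk) _.
rewrite /slope ler_pdivrMr ?subr_gt0// -/H Hj.
by have := Hle _ (x01 _ kN); lra.
Qed.
End Index.
End GridSlope.

(** * Bounds for the estimator by partial sums of ordered responses *)

Section MuHat.
Context {R : realType} (n : nat) (z : nat -> R * R).
Hypothesis n0 : (0 < n)%N.

Let n0R : 0 < n%:R :> R. Proof. by rewrite ltr0n. Qed.

Lemma Lambda_n_grid j : Lambda_n n z (j%:R / n%:R) = n%:R^-1 * \sum_(i < j) Yord n z i.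
Proof.
rewrite /Lambda_n mulrCA mulfV ?gt_eqF// mulr1 natrK.
by rewrite subrr mul0r addr0.
Qed.

Lemma Lambda_n_interp (a b : R) :
  (forall j, (j <= n)%N -> Lambda_n n z (j%:R / n%:R) <= a * (j%:R / n%:R) + b) ->
  forall s, s \in `[0, 1] -> Lambda_n n z s <= a * s + b.
Proof.
move=> hgrid s; rewrite in_itv/= => /andP[s0 s1].
have ns0 : 0 <= n%:R * s by rewrite mulr_ge0.
have := truncn_itv ns0; set k := Num.truncn (n%:R * s) => /andP[ks sk].
(* At s = 1 the index k is n, where [Yord] is a default value, so the grid bound is used
   directly. *)
have [kn|nk] := ltnP k n; last first.
  have -> : s = n%:R / n%:R.
    apply/eqP; rewrite (mulfV (lt0r_neq0 n0R)) eq_le s1/= -(ler_pM2l n0R) mulr1.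
    by apply: le_trans ks; rewrite ler_nat.
  exact: hgrid.
have hk := hgrid k (ltnW kn); have hk1 := hgrid k.+1 kn.
rewrite !Lambda_n_grid big_ord_recr/= in hk hk1.
rewrite /Lambda_n -/k; set S := \sum_(i < k) _ in hk hk1 *; set Y := Yord n z k in hk1 *.
pose l := n%:R * s - k%:R.
have l0 : 0 <= l by rewrite subr_ge0.
have l1 : l <= 1 by rewrite /l; move: sk; rewrite -natr1; lra.
rewrite (_ : _ + _ = (1 - l) * (n%:R^-1 * S) + l * (n%:R^-1 * (S + Y))); last first.
  by rewrite /l; field; rewrite gt_eqF.
apply: (@le_trans _ _ ((1 - l) * (a * (k%:R / n%:R) + b) + l * (a * (k.+1%:R / n%:R) + b))).
  by apply: lerD; apply: ler_wpM2l => //; rewrite subr_ge0.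
rewrite [leLHS](_ : _ = a * s + b)// /l -natr1; by field; rewrite gt_eqF.
Qed.

Definition rank_index (t : R) : nat :=
  minn (find (fun u : R * R => t <= u.1) (ordered_sample n z)).+1 n.

Let rank0 t : (0 < rank_index t)%N.
Proof. by rewrite /rank_index leq_min. Qed.

Let rankn t : (rank_index t <= n)%N.
Proof. exact: geq_minr. Qed.

Let mu_hatE t : mu_hat n z t =
  left_slope (lc_majorant01 (Lambda_n n z)) ((rank_index t)%:R / n%:R).
Proof.
by rewrite /mu_hat /lambda_hat gt_eqF// divr_gt0// ltr0n; exact: rank0.
Qed.

Let diffE i l : (i <= l)%N ->
  n%:R * (Lambda_n n z (l%:R / n%:R) - Lambda_n n z (i%:R / n%:R)) = \sum_(i <= j < l) Yord n z j.
Proof.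
move=> il; rewrite !Lambda_n_grid -mulrBr mulVKf ?gt_eqF//.
by rewrite -!(big_mkord xpredT) (big_cat_nat (n := i))//= addrAC subrr add0r.
Qed.

Lemma mu_hat_le (t a : R) i : (i < rank_index t)%N ->
  (forall l, (rank_index t <= l <= n)%N -> \sum_(i <= j < l) Yord n z j <= a * (l - i)%:R) ->
  mu_hat n z t <= a.
Proof.
move=> ik hi; rewrite mu_hatE.
apply: (grid_left_slope_le _ _ n0 Lambda_n_interp _ (rank0 t) (rankn t) _ i ik) => l kl.
have il : (i <= l)%N by case/andP: kl => kl _; exact: leq_trans (ltnW ik) kl.
rewrite -(ler_pM2l n0R) diffE//; apply: le_trans (hi l kl) _.
rewrite natrB// [leRHS](_ : _ = a * (l%:R - i%:R))//.
by field; rewrite gt_eqF.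
Qed.

Lemma mu_hat_ge (t a : R) l : (rank_index t <= l <= n)%N ->
  (forall i, (i < rank_index t)%N -> a * (l - i)%:R <= \sum_(i <= j < l) Yord n z j) ->
  a <= mu_hat n z t.
Proof.
move=> kl hl; rewrite mu_hatE.
apply: (grid_left_slope_ge _ _ n0 Lambda_n_interp _ (rank0 t) (rankn t) _ l kl) => i ik.
have il : (i <= l)%N by case/andP: kl => kl _; exact: leq_trans (ltnW ik) kl.
rewrite -(ler_pM2l n0R) diffE//; apply: le_trans _ (hl i ik).
rewrite natrB// [leLHS](_ : _ = a * (l%:R - i%:R))//.
by field; rewrite gt_eqF.
Qed.
End MuHat.

(** * Deviations of the estimator and runs of errors *)

Section SampleOrder.
Context {R : realType} (n : nat) (z : nat -> R * R).
Hypothesis n0 : (0 < n)%N.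

Let q (j : nat) := nth (0, 0) (ordered_sample n z) j.

Let size_q : size (ordered_sample n z) = n.
Proof. by rewrite size_sort size_mkseq. Qed.

Lemma sum_ordered (Q : pred (R * R)) (F : R * R -> R) :
  \sum_(p < n | Q (z p)) F (z p) = \sum_(0 <= j < n | Q (q j)) F (q j).
Proof.
transitivity (\sum_(v <- ordered_sample n z | Q v) F v).
  rewrite (perm_big (mkseq z n)) ?perm_sort//.
  by rewrite big_map -[in RHS](subn0 n) big_mkord.
by rewrite (big_nth (0, 0)) size_q.
Qed.

Lemma ordered_mem (j : nat) : (j < n)%N -> exists2 p : 'I_n, q j = z p & True.
Proof.
move=> jn; have : q j \in mkseq z n by rewrite -(mem_sort (fun u v => u.1 <= v.1)) mem_nth// size_q.
by move=> /mapP[p]; rewrite mem_iota => pn ->; exists (Ordinal pn).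
Qed.

Lemma mu_hat_abs (t B : R) : (forall p : 'I_n, `|(z p).2| <= B) -> `|mu_hat n z t| <= B.
Proof.
move=> hB; have hY j : (j < n)%N -> `|Yord n z j| <= B.
  by move=> /ordered_mem[p qp _]; rewrite /Yord -/(q j) qp.
have rk0 : (0 < rank_index n z t)%N by rewrite leq_min.
have sumle (G : nat -> R) (b : R) i l : (forall j, (i <= j < l)%N -> G j <= b) ->
    \sum_(i <= j < l) G j <= b * (l - i)%:R.
  move=> Gb; apply: (@le_trans _ _ (\sum_(i <= j < l) b)); first exact: ler_sum_nat.
  by rewrite sumr_const_nat mulr_natr.
rewrite ler_norml; apply/andP; split.
  apply: (@mu_hat_ge _ n z n0 t _ n); first by rewrite geq_minr leqnn.
  move=> i ik; rewrite mulNr lerNl -sumrN; apply: sumle => j /andP[_ jn].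
  by apply: le_trans (hY j jn); rewrite -normrN ler_norm.
apply: (@mu_hat_le _ n z n0 t _ 0%N) => // l /andP[_ ln]; apply: sumle => j /andP[_ jl].
by apply: le_trans (hY j (leq_trans jl ln)); rewrite ler_norm.
Qed.

Hypothesis noties : forall i j, (i < n)%N -> (j < n)%N -> i != j -> (z i).1 != (z j).1.

Lemma Xord_lt (i j : nat) : (i < j)%N -> (j < n)%N -> (q i).1 < (q j).1.
Proof.
move=> ij jn.
have unq : uniq [seq u.1 | u <- ordered_sample n z].
  rewrite (perm_uniq (perm_map _ (permEl (perm_sort _ _)))) -map_comp.
  rewrite map_inj_in_uniq ?iota_uniq// => a b; rewrite !mem_iota !add0n /= => an bn /eqP ab.
  by apply/eqP; apply: contraTT ab => nab; apply: noties.
have srt : sorted <=%O [seq u.1 | u <- ordered_sample n z].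
  rewrite sorted_map; apply: sort_sorted => u v; exact: le_total.
have : sorted <%O [seq u.1 | u <- ordered_sample n z] by rewrite lt_sorted_uniq_le unq.
move=> /(sorted_ltn_nth lt_trans (0 : R)) /(_ i j); rewrite !inE size_map size_q.
move=> /(_ (ltn_trans ij jn) jn ij).
by rewrite !(nth_map (0, 0)) ?size_q// (ltn_trans ij jn).
Qed.

Lemma Xord_le (i j : nat) : (i <= j)%N -> (j < n)%N -> (q i).1 <= (q j).1.
Proof. by rewrite leq_eqVlt => /predU1P[->//|ij] jn; apply: ltW; exact: Xord_lt. Qed.

Lemma find_ordered (Q : pred R) j : (forall a b, a <= b -> Q a -> Q b) -> (j < n)%N ->
  Q (q j).1 = (find (fun u => Q u.1) (ordered_sample n z) <= j)%N.
Proof.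
move=> Qup jn; apply/idP/idP => [Qj|fj].
  by rewrite leqNgt; apply/negP => /(before_find (0, 0)); rewrite -/(q j) Qj.
apply: Qup (Xord_le _ _ fj jn) _.
by apply: (nth_find (0, 0) (a := fun u : R * R => Q u.1)); rewrite has_find size_q (leq_ltn_trans fj).
Qed.

Hypothesis z01 : forall p, (p < n)%N -> (z p).1 \in `[0, 1].
Variable mu : R -> R.

Let bad sigma s t y := exists A : {set 'I_n},
  lower_set n (fun v : R * R => sigma * v.1) t A (fun p => z p) /\
  0 <= \sum_(p in A | s < sigma * (z p).1) (sigma * ((z p).2 - mu (z p).1) - y).

Let q01 j : (j < n)%N -> (q j).1 \in `[0, 1].
Proof. by move=> /ordered_mem[p -> _]; apply: z01. Qed.

Let index_of (p : 'I_n) : exists2 j, (j < n)%N & z p = q j.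
Proof.
have : z p \in ordered_sample n z.
  by rewrite mem_sort; apply/mapP; exists (val p) => //; rewrite mem_iota /=.
by move=> /(nthP (0, 0))[j]; rewrite size_q => jn <-; exists j.
Qed.

Let lower_le u t : t <= u ->
  lower_set n (fun v : R * R => 1 * v.1) t [set p : 'I_n | (z p).1 <= u] (fun p => z p).
Proof.
move=> tu; apply/andP; split; apply/forallP => i.
  by rewrite mul1r inE; apply/implyP => it; exact: le_trans tu.
apply/forallP => j; rewrite !inE !mul1r -ltNge; apply/implyP => /andP[iu].
exact: le_lt_trans.
Qed.

Let lower_ge u t : u <= t ->
  lower_set n (fun v : R * R => -1 * v.1) (- t) [set p : 'I_n | u <= (z p).1] (fun p => z p).
Proof.
move=> ut; apply/andP; split; apply/forallP => i.
  by rewrite mulN1r lerN2 inE; apply/implyP; exact: le_trans.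
apply/forallP => j; rewrite !inE !mulN1r -ltNge ltrN2; apply/implyP => /andP[iu ju].
exact: lt_le_trans iu.
Qed.

Let sum_range (Q : pred R) (F : R * R -> R) i l : (l <= n)%N ->
  (forall j, (j < n)%N -> Q (q j).1 = (i <= j < l)%N) ->
  \sum_(p < n | Q (z p).1) F (z p) = \sum_(i <= j < l) F (q j).
Proof.
move=> ln hQ; rewrite (sum_ordered (fun v => Q v.1)) big_mkcond.
transitivity (\sum_(0 <= j < n | (i <= j < l)%N) F (q j)).
  by rewrite [RHS]big_mkcond; apply: eq_big_nat => j /andP[_ jn]; rewrite hQ.
have [il|li] := leqP i l.
  rewrite (big_cat_nat (n := i)) ?(leq_trans il)//= [X in X + _]big1_seq ?add0r; last first.
    by move=> j; rewrite mem_index_iota => /andP[/andP[ij _] /andP[_]]; rewrite ltnNge ij.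
  rewrite (big_cat_nat (n := l))//= [X in _ + X]big1_seq ?addr0; last first.
    by move=> j; rewrite mem_index_iota => /andP[/andP[_ jl] /andP[]]; rewrite leqNgt jl.
  by rewrite big_nat_cond [RHS]big_nat_cond; apply: eq_bigl => j; rewrite andbb andbT.
rewrite [RHS]big_geq ?(ltnW li)// big1// => j /andP[ij jl].
by have := leq_ltn_trans ij (ltn_trans jl li); rewrite ltnn.
Qed.

(** Let i count the points up to s. By contraposition of [mu_hat_le], some run from i to an l at or
    beyond the rank has mean response above a, while mu <= a - y along it; so its errors have mean
    above y. *)
Lemma mu_hat_gt_bad s t a y : s < t ->
  (forall u, u \in `[0, 1] -> s < u -> mu u <= a - y) -> a < mu_hat n z t ->
  bad 1 s t y.
Proof.
move=> st hmu hat.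
(* Without a point in (s, t] the bad event holds trivially, with an empty sum. *)
have [[p /andP[sp pt]]|nop] := pselect (exists p : 'I_n, s < (z p).1 <= t); last first.
  exists [set p : 'I_n | (z p).1 <= t]%SET; split; first exact: lower_le.
  rewrite big_pred0// => p; rewrite inE mul1r; apply/negP => /andP[pt sp].
  by apply: nop; exists p; rewrite sp.
pose i := find (fun v => s < v.1) (ordered_sample n z).
pose k := find (fun v => t <= v.1) (ordered_sample n z).
have iE j : (j < n)%N -> (s < (q j).1) = (i <= j)%N.
  by move=> jn; apply: (find_ordered (fun v => s < v)) => // b c bc sb; exact: lt_le_trans bc.
have kE j : (j < n)%N -> (t <= (q j).1) = (k <= j)%N.
  by move=> jn; apply: (find_ordered (fun v => t <= v)) => // b c bc sb; exact: le_trans bc.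
have [j0 j0n pj0] := index_of p; rewrite pj0 in sp pt.
have ij0 : (i <= j0)%N by rewrite -iE.
have i_n : (i < n)%N by exact: leq_ltn_trans j0n.
have ik : (i <= k)%N.
  rewrite leqNgt; apply/negP => ki; have kn := ltn_trans ki i_n.
  have : t <= (q k).1 by rewrite kE.
  by rewrite leNgt => /negP; apply; apply: le_lt_trans st; rewrite leNgt iE// -ltnNge.
have irk : (i < rank_index n z t)%N by rewrite leq_min ltnS ik.
have [l [/andP[kl ln] hl]] : exists l, (rank_index n z t <= l <= n)%N /\
    a * (l - i)%:R < \sum_(i <= j < l) Yord n z j.
  apply: contrapT => nl; have := mu_hat_le n z n0 t a i irk.
  move=> h; have : mu_hat n z t <= a.
    apply: h => l kln; rewrite leNgt; apply/negP => hl.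
    by apply: nl; exists l.
  by rewrite leNgt hat.
have il : (i < l)%N by exact: leq_trans kl.
have l1n : (l.-1 < n)%N by rewrite prednK// (leq_trans _ il).
have l0 : (0 < l)%N by exact: leq_trans il.
(* The maximum matters when every point is below t: the rank is then capped at n and the run stops
   short of t. *)
pose u := Num.max t (q l.-1).1.
exists [set p : 'I_n | (z p).1 <= u]%SET; split.
  by apply: lower_le; rewrite le_max lexx.
rewrite (eq_bigl (fun p : 'I_n => s < (z p).1 <= u)); last first.
  by move=> p'; rewrite inE mul1r andbC.
rewrite (sum_range (fun v => s < v <= u) (fun v => 1 * (v.2 - mu v.1) - y) i l)//; last first.
  move=> j jn; rewrite iE//; congr andb; apply/idP/idP => [ju|jl]; last first.
    by rewrite le_max Xord_le ?orbT// -ltnS prednK.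
  rewrite ltnNge; apply/negP => lj.
  have : (q l.-1).1 < (q j).1 by apply: Xord_lt => //; rewrite prednK.
  move: ju; rewrite le_max => /orP[jt|/le_lt_trans/[apply]]; last by rewrite ltxx.
  have kj := leq_trans kl lj.
  have kj' : (k < j)%N.
    by move: kj; rewrite geq_min => /orP[//|nj]; have := leq_trans jn nj; rewrite ltnn.
  have kn := ltn_trans kj' jn.
  have := Xord_lt k j kj' jn; have : t <= (q k).1 by rewrite kE.
  by move=> tk /(le_lt_trans tk); rewrite ltNge jt.
apply: (@le_trans _ _ (\sum_(i <= j < l) (Yord n z j - a))).
  by rewrite sumrB sumr_const_nat -(mulr_natr a) subr_ge0 ltW.
apply: ler_sum_nat => j /andP[ij jl]; have jn := leq_trans jl ln.
have sj : s < (q j).1 by rewrite iE.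
have := hmu _ (q01 j jn) sj.
by rewrite mul1r /Yord -/(q j); lra.
Qed.

Lemma mu_hat_lt_bad s t a y : t < s ->
  (forall u, u \in `[0, 1] -> u < s -> a + y <= mu u) -> mu_hat n z t < a ->
  bad (-1) (- s) (- t) y.
Proof.
move=> ts hmu hat.
have [[p /andP[tp ps]]|nop] := pselect (exists p : 'I_n, t <= (z p).1 < s); last first.
  exists [set p : 'I_n | t <= (z p).1]%SET; split; first exact: lower_ge.
  rewrite big_pred0// => p; rewrite inE mulN1r ltrN2; apply/negP => /andP[pt sp].
  by apply: nop; exists p; rewrite pt.
pose l := find (fun v => s <= v.1) (ordered_sample n z).
pose k := find (fun v => t <= v.1) (ordered_sample n z).
have lE j : (j < n)%N -> (s <= (q j).1) = (l <= j)%N.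
  by move=> jn; apply: (find_ordered (fun v => s <= v)) => // b c bc sb; exact: le_trans bc.
have kE j : (j < n)%N -> (t <= (q j).1) = (k <= j)%N.
  by move=> jn; apply: (find_ordered (fun v => t <= v)) => // b c bc sb; exact: le_trans bc.
have [j0 j0n pj0] := index_of p; rewrite pj0 in tp ps.
have kj0 : (k <= j0)%N by rewrite -kE.
have j0l : (j0 < l)%N by rewrite ltnNge -lE// -ltNge.
have ln : (l <= n)%N by rewrite -[X in (_ <= X)%N]size_q find_size.
have kl : (rank_index n z t <= l)%N by rewrite geq_min (leq_ltn_trans kj0 j0l).
have [i [ik hi]] : exists i, (i < rank_index n z t)%N /\
    \sum_(i <= j < l) Yord n z j < a * (l - i)%:R.
  apply: contrapT => nl; have := mu_hat_ge n z n0 t a l.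
  rewrite kl ln => /(_ isT) h; have : a <= mu_hat n z t.
    apply: h => i ik; rewrite leNgt; apply/negP => hi.
    by apply: nl; exists i.
  by rewrite leNgt hat.
have il : (i < l)%N by exact: leq_trans kl.
have i_n : (i < n)%N by exact: leq_trans ln.
have ik1 : (i <= k)%N by move: ik; rewrite leq_min ltnS => /andP[].
(* Here i <= k, where k counts the points below t. For i = k the run starts at or after t, and the
   minimum is then t, as [lower_ge] requires. *)
pose u := Num.min t (q i).1.
exists [set p : 'I_n | u <= (z p).1]%SET; split.
  by apply: lower_ge; rewrite ge_min lexx.
rewrite (eq_bigl (fun p : 'I_n => u <= (z p).1 < s)); last first.
  by move=> p'; rewrite inE mulN1r ltrN2.
rewrite (sum_range (fun v => u <= v < s) (fun v => -1 * (v.2 - mu v.1) - y) i l)//; last first.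
  move=> j jn; rewrite (ltNge _ s) lE// -ltnNge; congr andb; apply/idP/idP => [uj|ij]; last first.
    by rewrite ge_min Xord_le ?orbT.
  rewrite leqNgt; apply/negP => ji.
  have := Xord_lt j i ji i_n.
  move: uj; rewrite ge_min => /orP[tj|/le_lt_trans/[apply]]; last by rewrite ltxx.
  by move: tj; rewrite kE// => kj; have := leq_trans ji (leq_trans ik1 kj); rewrite ltnn.
apply: (@le_trans _ _ (\sum_(i <= j < l) (a - Yord n z j))).
  by rewrite sumrB sumr_const_nat -(mulr_natr a) subr_ge0 ltW.
apply: ler_sum_nat => j /andP[ij jl]; have jn := leq_trans jl ln.
have sj : (q j).1 < s by rewrite ltNge lE// -ltnNge.
have := hmu _ (q01 j jn) sj.
by rewrite mulN1r /Yord -/(q j); lra.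
Qed.
End SampleOrder.

(** * Regression functions and generalized inverses *)

Section ClassF1.
Context {R : realType}.
Implicit Types (mu : R -> R) (a s t l : R).

Lemma has_deriv01_dist mu t l e : has_deriv01 mu t l -> 0 < e ->
  exists2 r, 0 < r & forall s, s \in `[0, 1] -> s != t -> `|t - s| < r ->
    `|l - (mu s - mu t) / (s - t)| < e.
Proof.
move=> /cvgrPdist_lt h e0; have /nbhs_ballP[r r0 hr] := h e e0.
by exists r => // s s01 st ts; apply: (hr s).
Qed.

(** A general filter serves the interior limits and the one-sided limits at the ends alike. *)
Lemma has_deriv01_cvg mu t l (F : set_system R) : Filter F -> has_deriv01 mu t l ->
  t \in `[0, 1] -> F --> t -> (\forall s \near F, s \in `[0, 1]) -> mu s @[s --> F] --> mu t.
Proof.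
move=> FF hd t01 Ft F01; apply/cvgrPdist_lt => e e0.
have [r r0 hr] := has_deriv01_dist _ _ _ _ hd ltr01.
have M0 : 0 < `|l| + 1 by rewrite ltr_wpDl.
have re0 : 0 < Num.min r (e / (`|l| + 1)) by rewrite lt_min r0 divr_gt0.
have near_t : \forall s \near F, ball t (Num.min r (e / (`|l| + 1))) s.
  by apply: Ft; exact: nbhsx_ballx.
apply: filterS2 near_t F01 => s /= st s01.
have [->|nst] := eqVneq s t; first by rewrite subrr normr0.
move: st; rewrite /ball/= lt_min => /andP[sr se].
have := hr s s01 nst sr.
have ts0 : 0 < `|s - t| by rewrite normr_gt0 subr_eq0.
set D := (mu s - mu t) / (s - t) => hD.
have DM : `|D| < `|l| + 1.
  rewrite (_ : D = l - (l - D)); last by ring.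
  by apply: le_lt_trans (ler_normB _ _) _; rewrite ltrD2l.
have : `|mu t - mu s| = `|D| * `|s - t|.
  by rewrite -normrM distrC /D mulfVK// subr_eq0.
move=> ->; apply: (@lt_trans _ _ ((`|l| + 1) * `|s - t|)); first by rewrite ltr_pM2r.
by rewrite mulrC -ltr_pdivlMr// distrC.
Qed.

Lemma classF1_MVT A1 A2 A3 mu s t : classF1 A1 A2 A3 mu -> s \in `[0, 1] -> t \in `[0, 1] ->
  s <= t -> A1 * (t - s) <= mu s - mu t <= A2 * (t - s).
Proof.
move=> [mono [[dmu hd] _]] s01 t01; rewrite le_eqVlt => /predU1P[->|st].
  by rewrite !subrr !mulr0 lexx.
have sub x : s <= x <= t -> x \in (`[0, 1] : interval R).
  move: s01 t01; rewrite !in_itv/= => /andP[s0 _] /andP[_ t1] /andP[sx xt].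
  by rewrite (le_trans s0 sx) (le_trans xt t1).
have cont x (F : set_system R) : Filter F -> s <= x <= t -> F --> x ->
    (\forall u \near F, s <= u <= t) -> mu u @[u --> F] --> mu x.
  move=> FF sxt Fx Fst; have [hx _] := hd x (sub _ sxt).
  by apply: has_deriv01_cvg hx _ Fx _; [exact: sub|apply: filterS Fst => u; exact: sub].
have der x : x \in `]s, t[ -> is_derive x 1 mu (dmu x).
  rewrite in_itv/= => /andP[sx xt]; have x01 : x \in (`[0, 1] : interval R) by apply: sub; rewrite !ltW.
  have [hx _] := hd x x01.
  have cv : h^-1 *: ((mu \o shift x) (h *: 1) - mu x) @[h --> 0^'] --> dmu x.
    apply/cvgrPdist_lt => e e0; have [r r0 hr] := has_deriv01_dist _ _ _ _ hx e0.
    have m0 : 0 < Num.min r (Num.min (x - s) (t - x)) by rewrite !lt_min r0 !subr_gt0 sx.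
    apply/nbhs_ballP; exists (Num.min r (Num.min (x - s) (t - x))) => //= h.
    rewrite /ball/= sub0r normrN !lt_min => /andP[hr' /andP[h1 h2]] h0.
    have := hr (h + x); rewrite addrK opprD addrCA subrr addr0 normrN hr' /shift/=.
    rewrite [h *: 1]mulr1 [_ *: _]mulrC; apply => //.
      apply: sub; move: h1 h2; rewrite !ltr_norml; lra.
    by rewrite -subr_eq0 addrK.
  by apply: DeriveDef; [exact: cvgP cv|exact: cvg_lim cv].
have [|c cst muc] := MVT_segment (ltW st) der.
  apply/continuous_within_itvP => //; split.
  - move=> x; rewrite in_itv/= => /andP[sx xt].
    apply: cont => //; first by rewrite !ltW.
    near=> u; apply/andP; split; apply: ltW; near: u; [exact: lt_nbhsr|exact: lt_nbhsl].
  - apply: cont => //; first by rewrite lexx ltW.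
      exact: cvg_at_right_filter.
    by near=> u; apply/andP; split; near: u; [exact: nbhs_right_ge|exact: nbhs_right_le].
  - apply: cont => //; first by rewrite lexx ltW.
      exact: cvg_at_left_filter.
    by near=> u; apply/andP; split; near: u; [exact: nbhs_left_ge|exact: nbhs_left_le].
have c01 : c \in (`[0, 1] : interval R) by apply: sub; rewrite in_itv in cst.
have [_ /andP[d1 d2]] := hd c c01.
have ts0 : 0 < t - s by rewrite subr_gt0.
(* Only the absolute value of the derivative is bounded; its sign comes from monotonicity. *)
have dc0 : dmu c <= 0.
  have := mono s t s01 t01 (ltW st); rewrite -subr_le0 muc.
  by rewrite pmulr_lle0.
have muE : mu s - mu t = `|dmu c| * (t - s).
  by rewrite ler0_norm// mulNr -muc opprB.
by rewrite muE !ler_pM2r// !ltW.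
Unshelve. all: by end_near. Qed.
End ClassF1.

Section GeneralizedInverse.
Context {R : realType}.
Implicit Types (h mu : R -> R) (a s t x g : R).

Let level h a := [set t : R | t \in `[0, 1] /\ a <= h t].

Let level_ub h a : has_ubound (level h a).
Proof. by exists 1 => t [+ _]; rewrite in_itv/= => /andP[]. Qed.

Lemma ginv01 h a : 0 <= ginv h a <= 1.
Proof.
rewrite /ginv -/(level h a); have [->|/set0P n0] := eqVneq (level h a) set0.
  by rewrite sup0 lexx ler01.
apply/andP; split; last by apply: ge_sup => // t [+ _]; rewrite in_itv/= => /andP[].
have [t ht] := n0; apply: le_trans (ub_le_sup (level_ub h a) ht).
by have [+ _] := ht; rewrite in_itv/= => /andP[].
Qed.

Lemma ginv_ge h a t : t \in `[0, 1] -> a <= h t -> t <= ginv h a.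
Proof. by move=> t01 aht; apply: ub_le_sup => //; exact: level_ub. Qed.

(** A point of the level set beyond [s] takes the place of an attained maximum; 0 <= s excludes the
    empty level set, where the convention is 0. *)
Lemma ginv_gt h a s : 0 <= s -> s < ginv h a -> exists t, [/\ t \in `[0, 1], s < t & a <= h t].
Proof.
move=> s0 sg; have [e0|/set0P n0] := eqVneq (level h a) set0.
  by move: sg; rewrite /ginv -/(level h a) e0 sup0 ltNge s0.
by have [t [t01 aht] st] := sup_gt n0 sg; exists t.
Qed.
End GeneralizedInverse.

(** This replaces the random point found from the inverse by a deterministic one. *)
Lemma bad_event_mono {R : realType} {T : Type} (Zs : nat -> T -> R * R) (mu : R -> R)
    n sigma s t t' y : t <= t' ->
  bad_event Zs mu n sigma s t' y `<=` bad_event Zs mu n sigma s t y.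
Proof.
move=> tt' w [A [/andP[/forallP lA mA] hA]]; exists A; split => //; apply/andP; split => //.
apply/forallP => i; apply/implyP => wt; have := lA i; rewrite (le_trans wt tt')//.
Qed.

(** * Tail bounds at a single level *)

Section Levels.
Local Open Scope ereal_scope.
Context {R : realType} {d : measure_display} {T : measurableType d}.
Variables (f : R -> R) (c C K alpha A1 A2 A3 : R).
Hypothesis mf : measurable_fun (`[0%R, 1%R]%classic : set R) f.
Hypothesis c0 : (0 < c)%R.
Hypothesis fcC : forall x, x \in `[0%R, 1%R] -> (c <= f x <= C)%R.
Hypothesis K0 : (0 < K)%R.
Hypothesis A10 : (0 < A1)%R.
Hypothesis A20 : (0 < A2)%R.
Variables (P : probability T R) (Z : {mfun T >-> (R * R)%type})
  (Zs : nat -> {mfun T >-> (R * R)%type}) (mu : R -> R).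
Hypothesis Z01 : forall x, (Z x).1 \in `[0%R, 1%R].
Hypothesis Zs01 : forall i x, (Zs i x).1 \in `[0%R, 1%R].
Hypothesis model : regression_model P f K alpha mu Z Zs.
Hypothesis mu_F1 : classF1 A1 A2 A3 mu.
Variable n : nat.
Hypothesis n0 : (0 < n)%N.

Let muA3 u : u \in `[0%R, 1%R] -> (`|mu u| <= A3)%R.
Proof. by have [_ [_]] := mu_F1; apply. Qed.

Definition noties (w : T) := forall i j, (i < n)%N -> (j < n)%N -> i != j ->
  (Zs i w).1 != (Zs j w).1.

(** A common upper bound for 8 K exp (4 alpha) and for every y and y^2 that occur below. It depends
    on neither mu nor n, so the rates are uniform. *)
Definition mgf_const : R := (8 * (K * expR (4 * alpha)) + A1 + A1 ^+ 2 + 1)%R.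

Let L := mgf_const.

Let K'0 : (0 <= K * expR (4 * alpha))%R.
Proof. by rewrite mulr_ge0 ?expR_ge0// ltW. Qed.

Lemma mgf_const_gt0 : (0 < L)%R.
Proof. by rewrite ltr_wpDl// !addr_ge0 ?sqr_ge0 ?mulr_ge0 ?expR_ge0// ltW. Qed.

Let tail (sigma s t y : R) :
  sigma = 1%R /\ (0 <= s)%R /\ (t <= 1)%R \/
  sigma = (-1)%R /\ (-1 <= s)%R /\ (t <= 0)%R ->
  (s < t)%R -> (0 < y)%R -> (y <= A1 + 1)%R -> (y ^+ 2 <= A1 ^+ 2 + 1)%R ->
  exists E : set T, [/\ measurable E, bad_event (fun i => Zs i) mu n sigma s t y `<=` E &
    P E <= (expR (- (c / (4 * L) * (n%:R * ((t - s) * y ^+ 2)))))%:E].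
Proof.
move=> h st y0 y1 y2; have A12 := sqr_ge0 A1.
apply: (@bad_event_tail _ _ _ f c C K alpha A3 mf c0 fcC K0 P Z Zs mu Z01 Zs01 muA3 model) => //.
- by rewrite /L /mgf_const; have := K'0; lra.
- by rewrite /L /mgf_const; have := K'0; lra.
- apply: (le_trans y2); rewrite /L /mgf_const; have := K'0; have := ltW A10; lra.
- exact: mgf_const_gt0.
Qed.

(* The exponent is c / (4 L) * n * h * y ^ 2 with h = x / (2 A2) and y = x / 4 at a
   point, h = x / 2 and y = A1 x / 8 for the inverses. *)
Definition mu_rate : R := (c / (4 * L) / (32 * A2))%R.
Definition inv_rate : R := (c / (4 * L) * (A1 ^+ 2 / 128))%R.

Let MVT s t : s \in `[0%R, 1%R] -> t \in `[0%R, 1%R] -> (s <= t)%R ->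
  (A1 * (t - s) <= mu s - mu t <= A2 * (t - s))%R.
Proof. exact: (classF1_MVT _ _ _ _ _ _ mu_F1). Qed.

Let union_bound (E1 E2 : set T) (b : R) : measurable E1 -> measurable E2 ->
  P E1 <= b%:E -> P E2 <= b%:E -> P (E1 `|` E2) <= (2 * b)%:E.
Proof.
move=> m1 m2 h1 h2; apply: le_trans (measureU2 _ m1 m2) _.
by rewrite mulrDl mul1r EFinD; exact: leeD.
Qed.

(** Of the deviation x, one half pays for the variation A2 h of mu over the window, one quarter is
    y, and one quarter is slack: the levels used are mu t + 3 x / 4 and mu t - 3 x / 4. *)
Lemma level_event_mu (t x : R) : (0 < t < 1)%R -> (0 < x <= 1)%R ->
  (x / (2 * A2) <= t)%R -> (x / (2 * A2) <= 1 - t)%R ->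
  exists E : set T, [/\ measurable E,
    forall w, noties w -> (x < `|mu_hat n (Zs ^~ w) t - mu t|)%R -> E w &
    P E <= (2 * expR (- (mu_rate * (n%:R * x ^+ 3))))%:E].
Proof.
have a1 := A10; have a2 := A20; move=> /andP[t0 t1] /andP[x0 x1]; set h := (x / (2 * A2))%R => ht h1t.
have h0 : (0 < h)%R by rewrite divr_gt0// mulr_gt0.
have hA2 : (A2 * h = x / 2)%R by rewrite /h; field; rewrite gt_eqF.
have t01 : t \in (`[0%R, 1%R] : interval R) by rewrite in_itv/= !ltW.
have x4 : (0 < x / 4)%R by rewrite divr_gt0.
have x4A : (x / 4 <= A1 + 1)%R by lra.
have x42 : ((x / 4) ^+ 2 <= A1 ^+ 2 + 1)%R.
  have : (0 <= A1 ^+ 2)%R by exact: sqr_ge0.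
  have : (x / 4 * (x / 4) <= 1 * 1)%R by apply: ler_pM; lra.
  by rewrite -expr2; lra.
have [||E1 [mE1 bE1 PE1]] := tail 1 (t - h) t (x / 4) _ _ x4 x4A x42.
- by left; split => //; split; [rewrite subr_ge0|exact: ltW].
- by rewrite gtrBl.
have [||E2 [mE2 bE2 PE2]] := tail (-1) (- (t + h)) (- t) (x / 4) _ _ x4 x4A x42.
- by right; split => //; split; [rewrite lerN2; lra|rewrite oppr_le0 ltW].
- by rewrite ltrN2 ltrDl.
have rE : (c / (4 * L) * (n%:R * (h * (x / 4) ^+ 2)) = mu_rate * (n%:R * x ^+ 3))%R.
  rewrite /mu_rate /h; field.
  by rewrite !gt_eqF// mgf_const_gt0.
rewrite (_ : t - (t - h) = h)%R in PE1; last by ring.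
rewrite (_ : - t - - (t + h) = h)%R in PE2; last by ring.
rewrite rE in PE1 PE2.
exists (E1 `|` E2); split; [exact: measurableU| |exact: union_bound].
move=> w nt; have [hat|hat] := leP (mu t) (mu_hat n (Zs ^~ w) t).
  rewrite ger0_norm ?subr_ge0// => xd; left; apply: bE1.
  apply: (@mu_hat_gt_bad _ n (Zs ^~ w) n0 nt _ mu (t - h)%R t (mu t + 3 / 4 * x)%R).
  - by move=> p _; exact: Zs01.
  - by rewrite gtrBl.
  - move=> u u01 hu; have [ut|tu] := leP u t.
      have /andP[_] := MVT u t u01 t01 ut.
      have : (A2 * (t - u) <= A2 * h)%R by rewrite ler_pM2l//; lra.
      lra.
    have /andP[+ _] := MVT t u t01 u01 (ltW tu).
    have : (0 <= A1 * (u - t))%R by rewrite mulr_ge0 ?subr_ge0 ?ltW.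
    lra.
  - lra.
rewrite ltr0_norm ?subr_lt0// => xd; right; apply: bE2.
apply: (@mu_hat_lt_bad _ n (Zs ^~ w) n0 nt _ mu (t + h)%R t (mu t - 3 / 4 * x)%R).
- by move=> p _; exact: Zs01.
- by rewrite ltrDl.
- move=> u u01 hu; have [tu|ut] := leP t u.
    have /andP[_] := MVT t u t01 u01 tu.
    have : (A2 * (u - t) <= A2 * h)%R by rewrite ler_pM2l//; lra.
    lra.
  have /andP[+ _] := MVT u t u01 t01 (ltW ut).
  have : (0 <= A1 * (t - u))%R by rewrite mulr_ge0 ?subr_ge0 ?ltW.
  lra.
- lra.
Qed.

(** Within distance x / 4 of g there is already a point where mu is on the expected side of a; at
    distances beyond x / 2, mu therefore differs from a by at least A1 x / 4 = 2 y. The window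
    consists of the distances between x / 2 and x. *)
Lemma level_event_inv (a x : R) : (0 < x)%R ->
  exists E : set T, [/\ measurable E,
    forall w, noties w -> (x < `|ginv (mu_hat n (Zs ^~ w)) a - ginv mu a|)%R -> E w &
    P E <= (2 * expR (- (inv_rate * (n%:R * x ^+ 3))))%:E].
Proof.
have a1 := A10; move=> x0; set g := ginv mu a; have /andP[g0 g1] : (0 <= g <= 1)%R by exact: ginv01.
pose y := (A1 * x / 8)%R.
have y0 : (0 < y)%R by rewrite divr_gt0// mulr_gt0.
have yA : (x <= 1)%R -> (y <= A1 + 1)%R.
  move=> x1; have : (A1 * x <= A1)%R by rewrite ler_piMr// ltW.
  by rewrite /y; have : (0 <= A1 * x)%R by [rewrite mulr_ge0 ?ltW]; lra.
have y2 : (x <= 1)%R -> (y ^+ 2 <= A1 ^+ 2 + 1)%R.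
  move=> x1; have yA1 : (y <= A1)%R.
    have : (A1 * x <= A1)%R by rewrite ler_piMr// ltW.
    by rewrite /y; have : (0 <= A1 * x)%R by [rewrite mulr_ge0 ?ltW]; lra.
  have : (y * y <= A1 * A1)%R by apply: ler_pM => //; exact: ltW.
  by rewrite -!expr2; lra.
have rE : (c / (4 * L) * (n%:R * (x / 2 * y ^+ 2)) = inv_rate * (n%:R * x ^+ 3))%R.
  rewrite /inv_rate /y; field.
  by rewrite gt_eqF// mgf_const_gt0.
have trivial_event : exists E : set T, [/\ measurable E, forall w : T, False -> E w &
    P E <= (expR (- (inv_rate * (n%:R * x ^+ 3))))%:E].
  by exists set0; split => //; rewrite measure0 lee_fin expR_ge0.
have [E1 [mE1 bE1 PE1]] : exists E : set T, [/\ measurable E,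
    forall w, noties w -> (g + x < ginv (mu_hat n (Zs ^~ w)) a)%R -> E w &
    P E <= (expR (- (inv_rate * (n%:R * x ^+ 3))))%:E].
  (* If g + x >= 1 the event is void, inverses being at most 1; otherwise x <= 1, which bounds y. *)
  have [gx1|gx1] := leP 1%R (g + x)%R.
    have [E [mE _ PE]] := trivial_event; exists E; split => // w _ gx.
    have /andP[_] := ginv01 (mu_hat n (Zs ^~ w)) a.
    by move/(lt_le_trans gx); rewrite ltNge gx1.
  have x1 : (x <= 1)%R by lra.
  have [||E [mE bE PE]] := tail 1 (g + x / 2) (g + x) y _ _ y0 (yA x1) (y2 x1).
  - by left; split => //; split; lra.
  - lra.
  rewrite (_ : g + x - (g + x / 2) = x / 2)%R in PE; last by field.
  rewrite rE in PE; exists E; split => // w nt gx.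
  have gx0 : (0 <= g + x)%R by lra.
  have [t' [t'01 gt' at']] := ginv_gt _ _ _ gx0 gx.
  apply: bE; apply: (bad_event_mono _ _ _ _ _ _ t'); first exact: ltW.
  (* The level is a - y because t' only gives a <= mu_hat, while a strict inequality is required. *)
  apply: (@mu_hat_gt_bad _ n (Zs ^~ w) n0 nt _ mu (g + x / 2)%R t' (a - y)%R).
  - by move=> p _; exact: Zs01.
  - lra.
  - move=> u u01 hu.
    have s01 : (g + x / 4)%R \in (`[0%R, 1%R] : interval R) by rewrite in_itv/=; lra.
    have mus : (mu (g + x / 4) < a)%R.
      rewrite ltNge; apply/negP => /(ginv_ge _ _ _ s01); rewrite -/g; lra.
    have su : (g + x / 4 <= u)%R by lra.
    have /andP[+ _] := MVT _ _ s01 u01 su.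
    have : (A1 * (x / 4) <= A1 * (u - (g + x / 4)))%R by rewrite ler_pM2l//; lra.
    by rewrite /y; lra.
  - lra.
have [E2 [mE2 bE2 PE2]] : exists E : set T, [/\ measurable E,
    forall w, noties w -> (ginv (mu_hat n (Zs ^~ w)) a < g - x)%R -> E w &
    P E <= (expR (- (inv_rate * (n%:R * x ^+ 3))))%:E].
  have [gx1|gx1] := leP (g - x)%R 0%R.
    have [E [mE _ PE]] := trivial_event; exists E; split => // w _ gx.
    have /andP[+ _] := ginv01 (mu_hat n (Zs ^~ w)) a.
    by move/le_lt_trans => /(_ _ gx); rewrite ltNge gx1.
  have x1 : (x <= 1)%R by lra.
  have [||E [mE bE PE]] := tail (-1) (- (g - x / 2)) (- (g - x)) y _ _ y0 (yA x1) (y2 x1).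
  - by right; split => //; split; lra.
  - lra.
  rewrite (_ : - (g - x) - - (g - x / 2) = x / 2)%R in PE; last by field.
  rewrite rE in PE; exists E; split => // w nt gx.
  have t01 : (g - x)%R \in (`[0%R, 1%R] : interval R) by rewrite in_itv/=; lra.
  have hat : (mu_hat n (Zs ^~ w) (g - x) < a)%R.
    rewrite ltNge; apply/negP => /(ginv_ge _ _ _ t01).
    by rewrite leNgt gx.
  apply: bE; apply: (@mu_hat_lt_bad _ n (Zs ^~ w) n0 nt _ mu (g - x / 2)%R (g - x)%R a).
  - by move=> p _; exact: Zs01.
  - lra.
  - move=> u u01 hu.
    have gx40 : (0 <= g - x / 4)%R by lra.
    have gx4 : (g - x / 4 < g)%R by lra.
    have [v [v01 gv av]] := ginv_gt _ _ _ gx40 gx4.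
    have uv : (u <= v)%R by lra.
    have /andP[+ _] := MVT _ _ u01 v01 uv.
    have : (A1 * (x / 4) <= A1 * (v - u))%R by rewrite ler_pM2l//; lra.
    by have : (0 <= A1 * x)%R by [rewrite mulr_ge0 ?ltW]; rewrite /y; lra.
  - exact: hat.
exists (E1 `|` E2); split; [exact: measurableU| |exact: union_bound].
move=> w nt; rewrite ltr_normr => /orP[h|h].
  by left; apply: bE1 => //; lra.
by right; apply: bE2 => //; lra.
Qed.
End Levels.

(** * From tail bounds to moments *)

Section NonmeasurableMajorant.
Local Open Scope ereal_scope.
Context {d : measure_display} {T : measurableType d} {R : realType}.
Variable P : probability T R.

(* [f] need not be measurable: its integral is a supremum over simple functions. *)
Lemma ge0_le_integral_majorant (f g : T -> \bar R) : (forall x, 0 <= f x) ->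
  (forall x, f x <= g x) -> \int[P]_x f x <= \int[P]_x g x.
Proof.
move=> f0 fg; rewrite !ge0_integralTE//; last by move=> x; exact: le_trans (fg x).
apply: le_ereal_sup => _ [h hf <-]; exists h => // x; exact: le_trans (hf x) (fg x).
Qed.

(** The value +oo added on the null set makes the majorant valid everywhere without changing its
    integral; the null set will contain the ties. *)
Lemma ge0_le_integral_null (f : T -> \bar R) (G : T -> R) (N : set T) :
  measurable N -> P N = 0 -> measurable_fun [set: T] G -> (forall x, 0 <= G x)%R ->
  (forall x, 0 <= f x) -> (forall x, ~ N x -> f x <= (G x)%:E) ->
  \int[P]_x f x <= \int[P]_x (G x)%:E.
Proof.
move=> mN N0 mG G0 f0 fG.
apply: (@le_trans _ _ (\int[P]_x ((G x)%:E + +oo * (\1_N x)%:E))).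
  apply: ge0_le_integral_majorant => // x; rewrite indicE.
  have [|xN] := boolP (x \in N); first by rewrite mule1 addey ?leey.
  by rewrite mule0 adde0 fG//; move: xN; rewrite notin_setE.
have m1 : measurable_fun [set: T] (fun x => (\1_N x)%:E : \bar R).
  by apply/measurable_EFinP; exact: measurable_indic.
rewrite ge0_integralD//; last 3 first.
- by move=> x _; rewrite lee_fin.
- exact/measurable_EFinP.
- by apply: emeasurable_funM.
by rewrite ge0_integralZl// integral_indic// setIT [X in _ * X]N0 mule0 adde0.
Qed.
End NonmeasurableMajorant.

Section Weights.
Context {R : realType}.

Lemma sum_inv_squares (N : nat) : \sum_(k < N) ((k.+1%:R : R) ^+ 2)^-1 <= 2.
Proof.
(* Telescoping by 1 / (N + 1)^2 <= 1 / N - 1 / (N + 1). The value 0 is set apart because 0^-1 = 0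
   breaks the step from 0 to 1. *)
suff h : N = 0%N \/ \sum_(k < N) ((k.+1%:R : R) ^+ 2)^-1 <= 2 - N%:R^-1.
  case: h => [->|h]; first by rewrite big_ord0.
  by apply: (le_trans h); rewrite gerBl invr_ge0.
elim: N => [|N IH]; first by left.
right; rewrite big_ord_recr/=; case: IH => [->|IH].
  by rewrite big_ord0 add0r expr1n invr1; lra.
case: N IH => [|N] IH; first by rewrite big_ord0 add0r expr1n invr1; lra.
apply: (le_trans (lerD IH (lexx _))).
rewrite -addrA lerD2l -subr_ge0.
have a0 : 0 < (N.+1%:R : R) by rewrite ltr0n.
rewrite (_ : N.+2%:R = N.+1%:R + 1 :> R); last by rewrite -natr1.
set a := N.+1%:R in a0 *.
rewrite (_ : _ - _ = (a * (a + 1) ^+ 2)^-1).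
  by rewrite invr_ge0 mulr_ge0 ?sqr_ge0// ltW.
by field; rewrite !gt_eqF//; lra.
Qed.

(** This is v^m <= m! exp v at v = 1 + a + u with m > q; the added 1 makes the power monotone in the
    exponent. *)
Lemma powR_le_exp (q a u : R) : 0 <= q -> 0 <= a -> 0 <= u ->
  (a + u) `^ q <= ((Num.truncn q).+1)`!%:R * expR (1 + a) * expR u.
Proof.
move=> q0 a0 u0; set m := (Num.truncn q).+1.
have au1 : 1 <= 1 + a + u by lra.
have au0 : 0 <= 1 + a + u by lra.
have m0 : 0 < (m`!%:R : R) by rewrite ltr0n fact_gt0.
apply: (@le_trans _ _ ((1 + a + u) `^ q)).
  by apply: ge0_ler_powR => //; rewrite ?nnegrE//; lra.
apply: (@le_trans _ _ ((1 + a + u) `^ m%:R)).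
  by apply: ler_powR => //; apply: ltW; exact: truncnS_gt.
rewrite powR_mulrn// -mulrA -expRD mulrC -ler_pdivrMr//.
have := @expR_ge1Dxn R (1 + a + u) (Num.truncn q) au0.
by apply: le_trans; rewrite lerDr.
Qed.

Lemma exp_decay (q kappa : R) : 0 < kappa -> exists N : nat, forall n : nat, (N <= n)%N ->
  (0 < n)%N -> n%:R `^ q * (2 * expR (- (kappa * n%:R))) <= 1.
Proof.
move=> k0; pose m := (Num.truncn q).+1.
(* From this rank on, 2 n^m is at most the term of order m + 1 in the series of exp (kappa n). *)
exists (Num.truncn (2 * (m.+1)`!%:R / kappa ^+ m.+1)).+1 => n Nn n0.
have n0R : 0 < (n%:R : R) by rewrite ltr0n.
have nN : 2 * (m.+1)`!%:R / kappa ^+ m.+1 <= n%:R.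
  by rewrite ltW// (lt_le_trans (truncnS_gt _))// ler_nat.
have n1 : 1 <= (n%:R : R) by rewrite ler1n.
apply: (@le_trans _ _ (n%:R `^ m%:R * (2 * expR (- (kappa * n%:R))))).
  rewrite ler_wpM2r ?mulr_ge0 ?expR_ge0// ler_powR//.
  by apply: ltW; exact: truncnS_gt.
rewrite powR_mulrn ?ler0n// expRN mulrA ler_pdivrMr ?expR_gt0// mul1r.
have kn0 : 0 <= kappa * n%:R by rewrite mulr_ge0 ?ltW.
apply: le_trans (_ : (kappa * n%:R) ^+ m.+1 / (m.+1)`!%:R <= _); last first.
  by apply: le_trans (expR_ge1Dxn m kn0); rewrite lerDr.
rewrite ler_pdivlMr ?ltr0n ?fact_gt0// exprMn (exprSr n%:R m).
move: nN; rewrite ler_pdivrMr ?exprn_gt0// => nN.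
rewrite -mulrA mulrCA; apply: ler_wpM2l; first exact: exprn_ge0.
by rewrite [leRHS]mulrC.
Qed.

Lemma weight_bound (p kappa : R) : 0 <= p -> 0 < kappa -> exists M : R, 0 < M /\
  forall k : nat, k.+1%:R `^ p * (2 * expR (- (kappa * k%:R ^+ 3))) <= M * (k.+1%:R ^+ 2)^-1.
Proof.
move=> p0 k0; pose m := (Num.truncn p).+1.
have f0 : 0 < ((m.+2)`!%:R : R) by rewrite ltr0n fact_gt0.
exists (2 * expR kappa * (m.+2)`!%:R / kappa ^+ m.+2); split.
  by rewrite divr_gt0 ?exprn_gt0// !mulr_gt0 ?expR_gt0.
move=> k; have k1 : 1 <= (k.+1%:R : R) by rewrite ler1n.
have k10 : 0 < (k.+1%:R : R) by rewrite ltr0n.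
(* Here k^3 >= k = (k + 1) - 1; the term of order m + 2 of the exponential series then leaves (k +
   1)^-2. *)
apply: (@le_trans _ _ (k.+1%:R `^ m%:R * (2 * expR (kappa - kappa * k.+1%:R)))).
  apply: ler_pM; rewrite ?powR_ge0 ?mulr_ge0 ?expR_ge0//.
    by apply: ler_powR => //; apply: ltW; exact: truncnS_gt.
  rewrite ler_pM2l// ler_expR -natr1 mulrDr mulr1 opprD addrCA subrr addr0 lerN2.
  rewrite ler_pM2l//; case: k {k1 k10} => [|k]; first by rewrite expr0n.
  by rewrite -[leLHS]expr1 ler_weXn2l// ler1n.
rewrite powR_mulrn ?ler0n// expRD expRN.
have kn0 : 0 <= kappa * k.+1%:R by rewrite mulr_ge0 ?ltW.
have h : (kappa * k.+1%:R) ^+ m.+2 / (m.+2)`!%:R <= expR (kappa * k.+1%:R).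
  by apply: le_trans (expR_ge1Dxn m.+1 kn0); rewrite lerDr.
have h0 : 0 < (kappa * k.+1%:R) ^+ m.+2 / (m.+2)`!%:R.
  by rewrite divr_gt0// exprn_gt0// mulr_gt0.
apply: (@le_trans _ _ (k.+1%:R ^+ m * (2 * (expR kappa * ((kappa * k.+1%:R) ^+ m.+2 / (m.+2)`!%:R)^-1)))).
  rewrite ler_wpM2l ?exprn_ge0// ler_pM2l// ler_pM2l ?expR_gt0//.
  by rewrite lef_pV2 ?posrE ?expR_gt0.
rewrite exprMn -[m.+2]addn2 (exprD k.+1%:R) le_eqVlt; apply/orP; left; apply/eqP.
by field; rewrite !gt_eqF ?exprn_gt0.
Qed.
End Weights.

Lemma limn_esup_le_eventually {R : realType} (u : (\bar R)^nat) (b : \bar R) (N : nat) :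
  (forall n, (N <= n)%N -> (u n <= b)%E) -> (limn_esup u <= b)%E.
Proof.
move=> ub; rewrite limn_esup_lim (cvg_lim _ (@cvg_esups_inf _ u))//.
apply: (@le_trans _ _ (esups u N)); first by apply: ereal_inf_lbound; exists N.
by apply: ge_ereal_sup => _ [k /= Nk <-]; exact: ub.
Qed.

Section TailMajorant.
Local Open Scope ereal_scope.
Context {d : measure_display} {T : measurableType d} {R : realType}.
Variables (P : probability T R) (D : T -> R) (p kappa nu M : R) (E : nat -> set T).
Hypothesis p0 : (0 < p)%R.
Hypothesis nu0 : (0 < nu)%R.
Hypothesis D01 : forall w, (0 <= D w <= 1)%R.
Hypothesis mE : forall k, measurable (E k).
Hypothesis PE : forall k, P (E k) <= (2 * expR (- (kappa * k%:R ^+ 3)))%:E.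
Hypothesis ME : forall k : nat,
  (k.+1%:R `^ p * (2 * expR (- (kappa * k%:R ^+ 3))) <= M * (k.+1%:R ^+ 2)^-1)%R.
Hypothesis M0 : (0 <= M)%R.

(** G sums ((k + 1) / nu)^p over the events [E k]. If k is the integer part of D nu, then D <= (k +
    1) / nu and, for k > 0, D > k / (2 nu), the factor 2 providing strictness. As D <= 1, only k <=
    nu occurs. *)
Lemma tail_majorant : exists G : T -> R, [/\ measurable_fun [set: T] G,
  forall w, (0 <= G w)%R,
  forall w, (forall k, (0 < k)%N -> (k%:R / (2 * nu) < D w)%R -> E k w) ->
    (D w `^ p <= G w)%R &
  \int[P]_w (G w)%:E <= (nu^-1 `^ p * (2 * M))%:E].
Proof.
(* The level 0 is always reached; its bound 2 exp 0 leaves room for the whole space. *)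
pose E' k := if k == 0%N then setT else E k.
have mE' k : measurable (E' k) by rewrite /E'; case: ifP.
have PE' k : P (E' k) <= (2 * expR (- (kappa * k%:R ^+ 3)))%:E.
  rewrite /E'; case: ifPn => [/eqP->|_]; last exact: PE.
  by rewrite probability_setT expr0n mulr0 oppr0 expR0 lee_fin; lra.
pose N := (Num.truncn nu).+1.
pose g (k : nat) w : R := (nu^-1 `^ p * k.+1%:R `^ p * \1_(E' k) w)%R.
have g0 k w : (0 <= g k w)%R by rewrite !mulr_ge0 ?powR_ge0// indicE.
have mg k : measurable_fun [set: T] (g k).
  by apply: measurable_funM => //; exact: measurable_indic.
exists (fun w => \sum_(k < N) g k w)%R; split.
- by apply: measurable_sum.
- by move=> w; apply: sumr_ge0.
- move=> w hw; have /andP[Dw0 Dw1] := D01 w.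
  have Dn0 : (0 <= D w * nu)%R by rewrite mulr_ge0// ltW.
  have /andP[] := truncn_itv Dn0; set k := Num.truncn (D w * nu) => kD Dk.
  have kN : (k < N)%N.
    rewrite -(ltr_nat R); apply: le_lt_trans (truncnS_gt nu).
    by apply: (le_trans kD); rewrite ler_piMl// ltW.
  have E'w : E' k w.
    rewrite /E'; case: eqP => // /eqP; rewrite -lt0n => k0; apply: hw => //.
    have k0R : (0 < (k%:R : R))%R by rewrite ltr0n.
    rewrite ltr_pdivrMr ?mulr_gt0// mulrCA; lra.
  rewrite (bigD1 (Ordinal kN))//=; apply: (@le_trans _ _ (g k w)); last first.
    by rewrite lerDl sumr_ge0.
  have nui0 : (0 <= nu^-1)%R by rewrite invr_ge0 ltW.
  rewrite /g indicE mem_set// mulr1 -powRM ?ler0n//.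
  apply: ge0_ler_powR; rewrite ?nnegrE ?mulr_ge0//; first exact: ltW.
  by rewrite mulrC ler_pdivlMr// ltW.
under eq_integral do rewrite -sumEFin.
rewrite ge0_integral_sum//; last 2 first.
- by move=> k; exact/measurable_EFinP.
- by move=> k w _; rewrite lee_fin.
apply: (@le_trans _ _ (\sum_(k < N) (nu^-1 `^ p * (M * (k.+1%:R ^+ 2)^-1))%:E)).
  apply: lee_sum => k _; rewrite /g.
  under eq_integral do rewrite EFinM.
  have m1 : measurable_fun [set: T] (fun w => (\1_(E' k) w)%:E : \bar R).
    by apply/measurable_EFinP; exact: measurable_indic.
  have c0 : 0 <= (nu^-1 `^ p * k.+1%:R `^ p)%:E by rewrite lee_fin mulr_ge0 ?powR_ge0.
  rewrite ge0_integralZl// integral_indic// setIT.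
  apply: (@le_trans _ _ ((nu^-1 `^ p * k.+1%:R `^ p)%:E *
      (2 * expR (- (kappa * k%:R ^+ 3)))%:E)).
    by apply: lee_wpmul2l => //; exact: PE'.
  by rewrite -EFinM lee_fin -mulrA ler_wpM2l ?powR_ge0.
rewrite sumEFin lee_fin -mulr_sumr ler_wpM2l ?powR_ge0// -mulr_sumr mulrC.
by rewrite ler_wpM2r// sum_inv_squares.
Qed.
End TailMajorant.

(** * Moment bounds for a fixed sample size *)

Section Moments.
Local Open Scope ereal_scope.
Context {R : realType} {d : measure_display} {T : measurableType d}.
Variables (f : R -> R) (c C K alpha A1 A2 A3 : R).
Hypothesis mf : measurable_fun (`[0%R, 1%R]%classic : set R) f.
Hypothesis c0 : (0 < c)%R.
Hypothesis fcC : forall x, x \in `[0%R, 1%R] -> (c <= f x <= C)%R.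
Hypothesis K0 : (0 < K)%R.
Hypothesis A10 : (0 < A1)%R.
Hypothesis A20 : (0 < A2)%R.
Variables (P : probability T R) (Z : {mfun T >-> (R * R)%type})
  (Zs : nat -> {mfun T >-> (R * R)%type}) (mu : R -> R).
Hypothesis Z01 : forall x, (Z x).1 \in `[0%R, 1%R].
Hypothesis Zs01 : forall i x, (Zs i x).1 \in `[0%R, 1%R].
Hypothesis model : regression_model P f K alpha mu Z Zs.
Hypothesis mu_F1 : classF1 A1 A2 A3 mu.
Variable n : nat.
Hypothesis n0 : (0 < n)%N.
Variable p : R.
Hypothesis p0 : (0 < p)%R.

Let muA3 u : u \in `[0%R, 1%R] -> (`|mu u| <= A3)%R.
Proof. by have [_ [_]] := mu_F1; apply. Qed.

Let n0R : (0 < n%:R :> R)%R. Proof. by rewrite ltr0n. Qed.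

Lemma noties_ae : exists N : set T, [/\ measurable N, P N = 0 &
  forall w, ~ N w -> noties Zs n w].
Proof.
pose tie i j : set T := [set w | i != j /\ (Zs i w).1 = (Zs j w).1].
have : P.-negligible (\bigcup_i \bigcup_j tie i j).
  apply: negligible_bigcup => i; apply: negligible_bigcup => j.
  have [ij|ij] := eqVneq i j; last first.
    exists [set w | (Zs i w).1 = (Zs j w).1]; split.
    - rewrite (_ : [set w | _] = (fun w => (Zs i w).1 == (Zs j w).1) @^-1` [set true]).
        rewrite -[X in measurable X]setTI; apply: measurable_fun_eqr => //.
          by apply: (measurableT_comp (@measurable_fst _ _ R R)).
        by apply: (measurableT_comp (@measurable_fst _ _ R R)).
      by apply/seteqP; split => w /eqP.
    - exact: (@prob_tie _ _ _ f c C K alpha mf c0 fcC P Z Zs mu Zs01 model).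
    - by move=> w [].
  exists set0; split => //.
  by move=> w []; rewrite ij eqxx.
move=> [N [mN N0 tN]]; exists N; split => // w nw i j _ _ ij.
by apply/eqP => tw; apply: nw; apply: tN; exists i => //; exists j.
Qed.

Let nu : R := (n%:R `^ 3^-1)%R.

Let nu0 : (0 < nu)%R. Proof. exact: powR_gt0. Qed.

Let nu3 : (nu ^+ 3 = n%:R)%R.
Proof. by rewrite -powR_mulrn ?ltW// -powRrM mulVf ?powRr1 ?ler0n. Qed.

(** The origin of the division by 8 in the rates: at level x = k / (2 nu), the quantity n x^3 is k^3
    / 8. *)
Let level_cube (k : nat) : (n%:R * (k%:R / (2 * nu)) ^+ 3 = k%:R ^+ 3 / 8)%R.
Proof. by rewrite -nu3; field; rewrite gt_eqF. Qed.

Lemma inv_moment (a M : R) : (0 <= M)%R ->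
  (forall k : nat, k.+1%:R `^ p * (2 * expR (- (inv_rate c K alpha A1 / 8 * k%:R ^+ 3)))
     <= M * (k.+1%:R ^+ 2)^-1)%R ->
  \int[P]_w (`|ginv (mu_hat n (Zs ^~ w)) a - ginv mu a| `^ p)%:E <=
  (nu^-1 `^ p * (2 * M))%:E.
Proof.
move=> M0 hM; pose D w := `|ginv (mu_hat n (Zs ^~ w)) a - ginv mu a|%R.
have D01 w : (0 <= D w <= 1)%R.
  rewrite normr_ge0/= ler_norml.
  have := ginv01 (mu_hat n (Zs ^~ w)) a; have := ginv01 mu a.
  by move=> /andP[? ?] /andP[? ?]; apply/andP; split; lra.
have /choice[E hE] k : exists E : set T, [/\ measurable E,
    forall w, noties Zs n w -> (0 < k)%N -> (k%:R / (2 * nu) < D w)%R -> E w &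
    P E <= (2 * expR (- (inv_rate c K alpha A1 / 8 * k%:R ^+ 3)))%:E].
  case: k => [|k].
    exists set0; split => //; rewrite measure0 lee_fin mulr_ge0// expR_ge0//.
  have x0 : (0 < k.+1%:R / (2 * nu))%R by rewrite divr_gt0 ?ltr0n// mulr_gt0.
  have [E [mE hE PE]] := @level_event_inv _ _ _ f c C K alpha A1 A2 A3 mf c0 fcC K0 A10
    P Z Zs mu Z01 Zs01 model mu_F1 n n0 a _ x0.
  exists E; split => //; first by move=> w nt _; exact: hE.
  by move: PE; rewrite level_cube mulrA mulrAC.
have [G [mG G0 hG intG]] := @tail_majorant _ _ _ P D p (inv_rate c K alpha A1 / 8) nu M E
  p0 nu0 D01 (fun k => let: And3 a _ _ := hE k in a) (fun k => let: And3 _ _ b := hE k in b)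
  hM M0.
have [N [mN N0 hN]] := noties_ae.
apply: le_trans intG; apply: (ge0_le_integral_null _ _ _ N) => //.
move=> w nw; rewrite lee_fin; apply: hG => k k0 kD.
by have [_ h _] := hE k; apply: h => //; exact: hN.
Qed.

Let A30 : (0 <= A3)%R.
Proof.
have : (0 : R)%R \in `[0%R, 1%R] by rewrite in_itv/= lexx ler01.
by move=> /muA3; apply: le_trans.
Qed.

Let B : R := (((Num.truncn (p * 2)).+1)`!%:R * expR (1 + 2 * A3))%R.

Let B0 : (0 <= B)%R. Proof. by rewrite mulr_ge0 ?expR_ge0. Qed.

Let W i w : R := (expR (2 * ((Zs i w).2 - mu (Zs i w).1)) +
                  expR (-2 * ((Zs i w).2 - mu (Zs i w).1)))%R.

Let W0 i w : (0 <= W i w)%R. Proof. by rewrite addr_ge0 ?expR_ge0. Qed.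

(** The deviation is at most 2 A3 plus the largest error, and the exponential of a maximum is at
    most a sum over all the errors. The square serves to truncate D^p at [b] in [mu_moment]. *)
Let mu_hat_crude t w : t \in `[0%R, 1%R] ->
  ((`|mu_hat n (Zs ^~ w) t - mu t| `^ p) ^+ 2 <= \sum_(i < n) B * W i w)%R.
Proof.
move=> t01; pose eps i := ((Zs i w).2 - mu (Zs i w).1)%R.
have [i0 [/andP[_ i0n] imax]] := max_range (fun i => `|eps i|%R) 0 n.-1 (leq0n _).
have i0n' : (i0 < n)%N by rewrite -(prednK n0).
have hY (q : 'I_n) : (`|(Zs q w).2| <= A3 + `|eps i0|)%R.
  rewrite (_ : (Zs q w).2 = mu (Zs q w).1 + eps q)%R; last by rewrite /eps; ring.
  apply: (le_trans (ler_normD _ _)); apply: lerD; first exact: muA3.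
  by apply: imax; rewrite /= -ltnS prednK.
have hat : (`|mu_hat n (Zs ^~ w) t - mu t| <= 2 * A3 + `|eps i0|)%R.
  apply: (le_trans (ler_normB _ _)).
  have := mu_hat_abs n (Zs ^~ w) n0 t _ hY; have := muA3 t t01; lra.
rewrite -powR_mulrn ?powR_ge0// -powRrM.
apply: (@le_trans _ _ ((2 * A3 + `|eps i0|) `^ (p * 2))%R).
  by apply: ge0_ler_powR; rewrite ?nnegrE ?mulr_ge0 ?addr_ge0 ?mulr_ge0// ltW.
apply: (@le_trans _ _ (B * W i0 w)%R); last first.
  by rewrite (bigD1 (Ordinal i0n'))//= lerDl sumr_ge0// => i _; rewrite mulr_ge0.
apply: (le_trans (powR_le_exp _ _ _ _ _ _)); rewrite ?mulr_ge0 ?(ltW p0)//.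
rewrite -/B ler_wpM2l// /W -/(eps i0).
have [e0|e0] := leP 0%R (eps i0).
  rewrite ger0_norm//; apply: (@le_trans _ _ (expR (2 * eps i0))).
    by rewrite ler_expR; lra.
  by rewrite lerDl expR_ge0.
rewrite ltr0_norm//; apply: (@le_trans _ _ (expR (-2 * eps i0))).
  by rewrite ler_expR; lra.
by rewrite lerDr expR_ge0.
Qed.

(** Only levels up to xm have their windows inside [0, 1]. The first term bounds the moment of D
    truncated at xm; the other two bound D^p on the event D > xm. *)
Lemma mu_moment (t M xm : R) : (0 <= M)%R ->
  (forall k : nat, k.+1%:R `^ p * (2 * expR (- (mu_rate c K alpha A1 A2 / 8 * k%:R ^+ 3)))
     <= M * (k.+1%:R ^+ 2)^-1)%R ->
  (0 < t < 1)%R -> (0 < xm <= 1)%R ->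
  (xm / (2 * A2) <= t)%R -> (xm / (2 * A2) <= 1 - t)%R ->
  \int[P]_w (`|mu_hat n (Zs ^~ w) t - mu t| `^ p)%:E <=
  (nu^-1 `^ p * (2 * M) +
   (n%:R `^ (1 + p) * (2 * expR (- (mu_rate c K alpha A1 A2 * (n%:R * xm ^+ 3)))) +
    (n%:R `^ (1 + p))^-1 * (n%:R * (B * (2 * K * expR (4 * alpha))))))%:E.
Proof.
move=> M0 hM t01 /andP[xm0 xm1] xmt xm1t.
have t01' : t \in (`[0%R, 1%R] : interval R) by case/andP: t01 => ? ?; rewrite in_itv/= !ltW.
pose D w := `|mu_hat n (Zs ^~ w) t - mu t|%R.
pose D1 w := Num.min (D w) xm.
have D01 w : (0 <= D1 w <= 1)%R.
  by rewrite le_min normr_ge0 (ltW xm0)/= ge_min xm1 orbT.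
have lev x : (0 < x)%R -> (x <= xm)%R -> exists E : set T, [/\ measurable E,
    forall w, noties Zs n w -> (x < D w)%R -> E w &
    P E <= (2 * expR (- (mu_rate c K alpha A1 A2 * (n%:R * x ^+ 3))))%:E].
  move=> x0 xxm; have x01 : (0 < x <= 1)%R by rewrite x0 (le_trans xxm).
  have xA : (x / (2 * A2) <= xm / (2 * A2))%R by rewrite ler_pM2r// invr_gt0 mulr_gt0.
  exact: (@level_event_mu _ _ _ f c C K alpha A1 A2 A3 mf c0 fcC K0 A10 A20
    P Z Zs mu Z01 Zs01 model mu_F1 n n0 t x t01 x01 (le_trans xA xmt) (le_trans xA xm1t)).
have /choice[E hE] k : exists E : set T, [/\ measurable E,
    forall w, noties Zs n w -> (0 < k)%N -> (k%:R / (2 * nu) < D1 w)%R -> E w &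
    P E <= (2 * expR (- (mu_rate c K alpha A1 A2 / 8 * k%:R ^+ 3)))%:E].
  have triv : P set0 <= (2 * expR (- (mu_rate c K alpha A1 A2 / 8 * k%:R ^+ 3)))%:E.
    by rewrite measure0 lee_fin mulr_ge0// expR_ge0.
  case: k triv => [|k] triv; first by exists set0; split.
  have x0 : (0 < k.+1%:R / (2 * nu))%R by rewrite divr_gt0 ?ltr0n// mulr_gt0.
  have [xxm|xxm] := leP (k.+1%:R / (2 * nu))%R xm; last first.
    exists set0; split => // w _ _; rewrite /D1 lt_min => /andP[_].
    by rewrite ltNge (ltW xxm).
  have [E [mE hE PE]] := lev _ x0 xxm.
  exists E; split => //; first by move=> w nt _; rewrite lt_min => /andP[+ _]; exact: hE.
  by move: PE; rewrite level_cube mulrA mulrAC.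
have [G [mG G0 hG intG]] := @tail_majorant _ _ _ P D1 p (mu_rate c K alpha A1 A2 / 8) nu M E
  p0 nu0 D01 (fun k => let: And3 a _ _ := hE k in a) (fun k => let: And3 _ _ b := hE k in b)
  hM M0.
have [Em [mEm hEm PEm]] := lev _ xm0 (lexx _).
have [N [mN N0 hN]] := noties_ae.
(* This power makes the last term harmless, n^(p / 3) n / b being n^(- 2 p / 3), and is still
   absorbed by the exponential bound on [Em]. *)
pose b : R := (n%:R `^ (1 + p))%R.
have b0 : (0 < b)%R by exact: powR_gt0.
have mW i : measurable_fun [set: T] (W i).
  by have [] := @exp_moment _ _ _ f K alpha A3 P Z Zs mu Z01 Zs01 muA3 model i.
have intW i : \int[P]_w (W i w)%:E <= (2 * K * expR (4 * alpha))%:E.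
  by have [] := @exp_moment _ _ _ f K alpha A3 P Z Zs mu Z01 Zs01 muA3 model i.
(* Once D > xm, either D^p <= b or D^p <= D^(2 p) / b. *)
pose H2 w : R := (b * \1_Em w)%R.
pose H3 w : R := (b^-1 * \sum_(i < n) B * W i w)%R.
have mH2 : measurable_fun [set: T] H2 by apply: measurable_funM => //; exact: measurable_indic.
have mS : measurable_fun [set: T] (fun w => \sum_(i < n) B * W i w)%R.
  by apply: measurable_sum => i; exact: measurable_funM.
have mH3 : measurable_fun [set: T] H3 by exact: measurable_funM.
have S0 w : (0 <= \sum_(i < n) B * W i w)%R by apply: sumr_ge0 => i _; rewrite mulr_ge0.
have H20 w : (0 <= H2 w)%R by rewrite /H2 indicE mulr_ge0// ltW.
have H30 w : (0 <= H3 w)%R by rewrite /H3 mulr_ge0// invr_ge0 ltW.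
apply: (@le_trans _ _ (\int[P]_w (G w + (H2 w + H3 w))%:E)).
  apply: (ge0_le_integral_null _ _ (fun w => G w + (H2 w + H3 w))%R N) => //.
  - by apply: measurable_funD => //; exact: measurable_funD.
  - by move=> w; rewrite !addr_ge0.
  move=> w nw; rewrite lee_fin -/(D w).
  have nt := hN w nw.
  have [Dxm|xmD] := leP (D w) xm.
    rewrite (_ : D w = D1 w); last by apply/esym/min_idPl.
    apply: (@le_trans _ _ (G w)); last by rewrite lerDl addr_ge0.
    by apply: hG => k k0 kD; have [_ h _] := hE k; exact: h.
  apply: (@le_trans _ _ (H2 w + H3 w)%R); last by rewrite lerDr.
  rewrite /H2 indicE mem_set ?mulr1; last exact: hEm.
  have [Db|bD] := leP (D w `^ p)%R b; first by rewrite (le_trans Db)// lerDl.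
  apply: (@le_trans _ _ (H3 w)); last by rewrite lerDr ltW.
  rewrite /H3 mulrC ler_pdivlMr//.
  apply: le_trans (mu_hat_crude t w t01'); rewrite -/(D w) expr2.
  by rewrite ler_wpM2l ?powR_ge0// ltW.
under eq_integral do rewrite EFinD.
rewrite ge0_integralD//; last 4 first.
- by move=> w _; rewrite lee_fin.
- exact/measurable_EFinP.
- by move=> w _; rewrite lee_fin addr_ge0.
- by apply/measurable_EFinP; exact: measurable_funD.
rewrite EFinD; apply: leeD => //.
under eq_integral do rewrite EFinD.
rewrite ge0_integralD//; last 4 first.
- by move=> w _; rewrite lee_fin.
- exact/measurable_EFinP.
- by move=> w _; rewrite lee_fin.
- exact/measurable_EFinP.
rewrite EFinD; apply: leeD.
  under eq_integral do rewrite EFinM.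
  have b0' : 0 <= b%:E by rewrite lee_fin ltW.
  have m1 : measurable_fun [set: T] (fun w => (\1_Em w)%:E : \bar R).
    by apply/measurable_EFinP; exact: measurable_indic.
  rewrite ge0_integralZl// integral_indic// setIT EFinM.
  by apply: lee_wpmul2l.
under eq_integral do rewrite EFinM.
have b0' : 0 <= (b^-1)%:E by rewrite lee_fin invr_ge0 ltW.
rewrite ge0_integralZl//; last 2 first.
- exact/measurable_EFinP.
- by move=> w _; rewrite lee_fin.
rewrite EFinM; apply: lee_wpmul2l => //.
under eq_integral do rewrite -sumEFin.
rewrite ge0_integral_sum//; last 2 first.
- by move=> i; apply/measurable_EFinP; exact: measurable_funM.
- by move=> i w _; rewrite lee_fin mulr_ge0.
apply: (@le_trans _ _ (\sum_(i < n) (B * (2 * K * expR (4 * alpha)))%:E)); last first.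
  by rewrite sumEFin lee_fin sumr_const card_ord -[leLHS]mulr_natl.
apply: lee_sum => i _.
under eq_integral do rewrite EFinM.
rewrite ge0_integralZl//; last 2 first.
- exact/measurable_EFinP.
- by move=> w _; rewrite lee_fin.
by rewrite (EFinM B); apply: lee_wpmul2l; rewrite ?lee_fin // intW.
Qed.
End Moments.

(** * Passage to the limit superior *)

Lemma powR_cancel {R : realType} (n : nat) (p : R) : (0 < n)%N ->
  n%:R `^ (p / 3) * (n%:R `^ 3^-1)^-1 `^ p = 1 :> R.
Proof.
move=> n0; have n0R : n%:R != 0 :> R by rewrite pnatr_eq0 -lt0n.
rewrite -powRN -powRrM -powRD ?n0R ?implybT//.
by rewrite [X in _ `^ X](_ : _ = 0) ?powRr0//; ring.
Qed.

Theorem corollary4p2 (R : realType) (A1 A2 A3 : R)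
  (hA1 : 0 < A1) (hA2 : 0 < A2) (hA3 : 0 < A3)
  (f : R -> R) (hfm : measurable_fun (`[0, 1]%classic : set R) f)
  (hf : exists c C : R, 0 < c /\ forall x : R, x \in `[0, 1] -> c <= f x <= C)
  (K alpha : R) (hK : 0 < K) (halpha : 0 < alpha)
  (d : measure_display) (T : measurableType d)
  (P : (R -> R) -> probability T R)
  (Z : {mfun T >-> (R * R)%type}) (Zs : nat -> {mfun T >-> (R * R)%type})
  (hZ : forall w, (Z w).1 \in `[0, 1])
  (hZs : forall i w, (Zs i w).1 \in `[0, 1])
  (hmodel : forall mu, classF1 A1 A2 A3 mu ->
     regression_model (P mu) f K alpha mu Z Zs) :
  forall p : R, 1 <= p -> exists Kp : R, 0 < Kp /\
    (forall a : R,
       (limn_esup (fun n => ereal_sup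
          [set (n%:R `^ (p / 3))%:E *
               'E_(P mu)[fun w => (`|ginv (mu_hat n (Zs ^~ w)) a
                                      - ginv mu a| `^ p)%R]
          | mu in classF1 A1 A2 A3]) <= Kp%:E)%E) /\
    (forall t : R, 0 < t < 1 ->
       (limn_esup (fun n => ereal_sup
          [set (n%:R `^ (p / 3))%:E *
               'E_(P mu)[fun w => (`|mu_hat n (Zs ^~ w) t - mu t| `^ p)%R]
          | mu in classF1 A1 A2 A3]) <= Kp%:E)%E).
Proof.
have [c [C [c0 fcC]]] := hf.
move=> p p1; have p0 : 0 < p by exact: lt_le_trans p1.
have L0 := mgf_const_gt0 K alpha A1 hK hA1.
have r10 : 0 < inv_rate c K alpha A1 / 8.
  by rewrite /inv_rate !(mulr_gt0, invr_gt0, exprn_gt0).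
have r20 : 0 < mu_rate c K alpha A1 A2.
  by rewrite /mu_rate !(mulr_gt0, invr_gt0).
have r28 : 0 < mu_rate c K alpha A1 A2 / 8 by rewrite divr_gt0.
have [M1 [M10 hM1]] := weight_bound p _ (ltW p0) r10.
have [M2 [M20 hM2]] := weight_bound p _ (ltW p0) r28.
pose S : R := (((Num.truncn (p * 2)).+1)`!%:R * expR (1 + 2 * A3)) *
  (2 * K * expR (4 * alpha)).
have S0 : 0 <= S.
  by rewrite /S !(mulr_ge0, expR_ge0, ler0n)// ltW.
(* Neither [a] nor [t] enters this constant: [xm] depends on t, but appears only in the exponential
   term, which is at most 1 from a rank that may depend on t. *)
exists (2 * M1 + (2 * M2 + (1 + S))); split; first by lra.
split=> [a|t t01].
  apply: (@limn_esup_le_eventually _ _ _ 1%N) => n n0.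
  apply: ge_ereal_sup => _ [mu hmu <-].
  have q0 : (0 <= (n%:R `^ (p / 3))%:E :> \bar R)%E by rewrite lee_fin powR_ge0.
  have := @inv_moment R d T f c C K alpha A1 A2 A3 hfm c0 fcC hK hA1 (P mu) Z Zs mu hZ hZs
    (hmodel mu hmu) hmu n n0 p p0 a M1 (ltW M10) hM1.
  move=> /(lee_wpmul2l q0); rewrite unlock; move=> /le_trans; apply.
  rewrite -EFinM lee_fin (mulrA (_ `^ (p / 3))) powR_cancel// mul1r; lra.
(* The largest level up to 1 for which the windows on both sides of t stay in [0, 1]. *)
pose xm : R := Num.min 1 (Num.min (2 * A2 * t) (2 * A2 * (1 - t))).
have /andP[t0 t1] := t01.
have A22 : 0 < 2 * A2 by rewrite mulr_gt0.
have xm01 : 0 < xm <= 1.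
  by rewrite /xm !lt_min ltr01 !mulr_gt0 ?subr_gt0//= ge_min lexx.
have xmt : xm / (2 * A2) <= t.
  by rewrite ler_pdivrMr// mulrC /xm !ge_min lexx orbT.
have xm1t : xm / (2 * A2) <= 1 - t.
  by rewrite ler_pdivrMr// mulrC /xm !ge_min lexx !orbT.
have rxm : 0 < mu_rate c K alpha A1 A2 * xm ^+ 3.
  by rewrite mulr_gt0// exprn_gt0//; case/andP: xm01.
have [N hN] := exp_decay (p / 3 + (1 + p)) _ rxm.
apply: (@limn_esup_le_eventually _ _ _ N.+1) => n Nn.
have n0 : (0 < n)%N by exact: leq_trans Nn.
have n0R : n%:R != 0 :> R by rewrite pnatr_eq0 -lt0n.
apply: ge_ereal_sup => _ [mu hmu <-].
have q0 : (0 <= (n%:R `^ (p / 3))%:E :> \bar R)%E by rewrite lee_fin powR_ge0.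
have := @mu_moment R d T f c C K alpha A1 A2 A3 hfm c0 fcC hK hA1 hA2 (P mu) Z Zs mu hZ hZs
  (hmodel mu hmu) hmu n n0 p p0 t M2 xm (ltW M20) hM2 t01 xm01 xmt xm1t.
move=> /(lee_wpmul2l q0); rewrite unlock; move=> /le_trans; apply.
rewrite -EFinM lee_fin -/S !(mulrDr (_ `^ (p / 3))).
rewrite (mulrA (_ `^ (p / 3)) (_ `^ p)) powR_cancel// mul1r.
rewrite -[leLHS]add0r; apply: lerD; first by rewrite mulr_ge0// ltW.
apply: lerD => //; apply: lerD.
  rewrite (mulrA (_ `^ (p / 3))) -powRD ?n0R ?implybT//.
  by rewrite (mulrC n%:R (xm ^+ 3)) (mulrA (mu_rate _ _ _ _ _)) hN// ltnW.
rewrite (mulrA _^-1) (mulrA (_ `^ (p / 3))) ler_piMl//.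
rewrite -{3}(powRr1 (ler0n R n)) -powRN -!powRD ?n0R ?implybT//.
rewrite -[leRHS](powRr0 (n%:R : R)) ler_powR ?ler1n//; lra.
Qed.
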